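(* Let $m,n\ge 1$ be integers, let $A(m,n)$ be the aisle graph with reward function $r$ and unit edge costs, and let $B\ge 0$ be a budget. There is an algorithm that solves the full-row constant-cost orienteering problem COP-FR on $(A(m,n),r,B)$ optimally, i.e. that outputs a full-row closed walk starting and ending at $v_{1,0}$ of cost at most $B$ whose collected reward is maximum among all such full-row closed walks, and it runs in time $\mathcal{O}(m\cdot\max\{n,\log m\})$.
   Context: The aisle graph $A(m,n)=(V,E)$ has vertex set $V=\{v_{i,j}: 1\le i\le m,\ 0\le j\le n+1\}$ (rows $i$, columns $j$). Its edges are: the horizontal edges $\{v_{i,j},v_{i,j+1}\}$ for $1\le i\le m$, $0\le j\le n$; and the vertical edges $\{v_{i,0},v_{i+1,0}\}$ and $\{v_{i,n+1},v_{i+1,n+1}\}$ for $1\le i\le m-1$. Every edge has cost $1$. A reward function $r:V\to\mathbb{R}_{\ge 0}$ is given with $r(v_{i,0})=r(v_{i,n+1})=0$ for all $i$. The cost of a walk is its number of edge traversals (counted with multiplicity); the reward collected by a walk is the sum of $r(v)$ over the distinct vertices $v$ it visits (each vertex's reward is collected at most once). The constant-cost orienteering problem (COP) asks for a closed walk starting and ending at $v_{1,0}$ of cost at most $B$ with maximum collected reward. A closed walk is full-row if it never reverses direction at a vertex $v_{i,j}$ with $1\le j\le n$, i.e. whenever it enters a row at one end it traverses that entire row to the other end. COP-FR is COP restricted to full-row closed walks. Running time is measured with unit-cost arithmetic and comparison operations on rewards. *)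

(* Defs.v *)
From HB Require Import structures.
From mathcomp Require Import all_boot all_order all_algebra.
From mathcomp Require Export reals exp.

Set Implicit Arguments.
Unset Strict Implicit.
Unset Printing Implicit Defensive.

Import Order.TTheory GRing.Theory Num.Theory.
Local Open Scope ring_scope.

Section AisleGraph.

(* The pair (i, j) stands for v_{i,j}: rows 1 .. m, columns 0 .. n+1. *)
Definition vertex : Type := (nat * nat)%type.

Variables m n : nat.

Definition aisle_vertex (v : vertex) : bool :=
  ((1 <= v.1 <= m) && (v.2 <= n.+1))%N.

Definition aisle_arc (u v : vertex) : bool :=
  [&& aisle_vertex u, aisle_vertex v &
      ((v.1 == u.1) && (v.2 == u.2.+1))
      || [&& v.1 == u.1.+1, v.2 == u.2 & (u.2 == 0) || (u.2 == n.+1)]]%N.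

Definition aisle_edge (u v : vertex) : bool := aisle_arc u v || aisle_arc v u.

(* A walk is given by the nonempty sequence of the vertices it visits, in
   order; it traverses one edge less than it has entries. *)
Definition closed_walk (v : vertex) (w : seq vertex) : bool :=
  if w is x :: p then
    [&& x == v, aisle_vertex x, path aisle_edge x p & last x p == v]
  else false.

Definition walk_cost (w : seq vertex) : nat := (size w).-1.

(* Reversing direction at the vertex of index k.+1 of the walk is going back
   to the vertex of index k.  The ends of a closed walk based at v_{1,0} are
   not in columns 1 .. n, so only inner positions matter. *)
Definition full_row (w : seq vertex) : Prop :=
  forall k : nat, (k.+2 < size w)%N ->
    (1 <= (nth (0, 0)%N w k.+1).2 <= n)%N ->
    nth (0, 0)%N w k.+2 <> nth (0, 0)%N w k.

Variable R : realType.

Definition walk_reward (r : vertex -> R) (w : seq vertex) : R :=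
  \sum_(v <- undup w) r v.

Definition aisle_reward (r : vertex -> R) : Prop :=
  [/\ forall v, aisle_vertex v -> 0 <= r v,
      forall i, (1 <= i <= m)%N -> r (i, 0%N) = 0
    & forall i, (1 <= i <= m)%N -> r (i, n.+1) = 0].

Definition cop_fr_feasible (B : R) (w : seq vertex) : Prop :=
  [/\ closed_walk (1, 0)%N w, full_row w & (walk_cost w)%:R <= B].

Definition cop_fr_optimal (r : vertex -> R) (B : R) (w : seq vertex) : Prop :=
  cop_fr_feasible B w /\
  forall w', cop_fr_feasible B w' -> walk_reward r w' <= walk_reward r w.

End AisleGraph.

(* A real RAM, presented as a structured programming language.  The memory
   consists of arrays of naturals and arrays of reals; an array is named by a
   constant of the program, and its cells are addressed by computed naturals.
   Reals cannot be converted to naturals (there is no rounding), and the only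
   real constants are 0 and 1, so that a program is a finite object that does
   not depend on the instance.  Every constant, memory access, arithmetic
   operation, comparison and connective costs one time unit. *)

Inductive nexp : Type :=
| NConst of nat
| NLoad of nat & nexp
| NAdd of nexp & nexp
| NSub of nexp & nexp.

Inductive rexp : Type :=
| RZero
| ROne
| RLoad of nat & nexp
| RAdd of rexp & rexp
| RSub of rexp & rexp
| RMul of rexp & rexp
| RDiv of rexp & rexp.

Inductive bexp : Type :=
| BLeN of nexp & nexp
| BLeR of rexp & rexp
| BNot of bexp
| BAnd of bexp & bexp.

Inductive prog : Type :=
| Skip
| NStore of nat & nexp & nexp
| RStore of nat & nexp & rexp
| Seq of prog & prog
| If of bexp & prog & prog
| While of bexp & prog.

Fixpoint ncost (e : nexp) : nat :=
  match e with
  | NConst _ => 1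
  | NLoad _ e1 => (ncost e1).+1
  | NAdd e1 e2 | NSub e1 e2 => (ncost e1 + ncost e2).+1
  end.

Fixpoint rcost (e : rexp) : nat :=
  match e with
  | RZero | ROne => 1
  | RLoad _ e1 => (ncost e1).+1
  | RAdd e1 e2 | RSub e1 e2 | RMul e1 e2 | RDiv e1 e2 =>
      (rcost e1 + rcost e2).+1
  end.

Fixpoint bcost (b : bexp) : nat :=
  match b with
  | BLeN e1 e2 => (ncost e1 + ncost e2).+1
  | BLeR e1 e2 => (rcost e1 + rcost e2).+1
  | BNot b1 => (bcost b1).+1
  | BAnd b1 b2 => (bcost b1 + bcost b2).+1
  end.

Section Semantics.

Variable R : realType.

Record state : Type := State {
  nmem : nat -> nat -> nat;
  rmem : nat -> nat -> R
}.

Definition upd (T : Type) (mem : nat -> nat -> T) (a i : nat) (x : T) :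
    nat -> nat -> T :=
  fun a' i' => if (a' == a) && (i' == i) then x else mem a' i'.

Fixpoint neval (s : state) (e : nexp) : nat :=
  match e with
  | NConst k => k
  | NLoad a e1 => nmem s a (neval s e1)
  | NAdd e1 e2 => (neval s e1 + neval s e2)%N
  | NSub e1 e2 => (neval s e1 - neval s e2)%N
  end.

Fixpoint reval (s : state) (e : rexp) : R :=
  match e with
  | RZero => 0
  | ROne => 1
  | RLoad a e1 => rmem s a (neval s e1)
  | RAdd e1 e2 => reval s e1 + reval s e2
  | RSub e1 e2 => reval s e1 - reval s e2
  | RMul e1 e2 => reval s e1 * reval s e2
  | RDiv e1 e2 => reval s e1 / reval s e2
  end.

Fixpoint beval (s : state) (b : bexp) : bool :=
  match b with
  | BLeN e1 e2 => (neval s e1 <= neval s e2)%N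
  | BLeR e1 e2 => reval s e1 <= reval s e2
  | BNot b1 => ~~ beval s b1
  | BAnd b1 b2 => beval s b1 && beval s b2
  end.

(* exec P s t s': started in s, the program P halts in s' after t time units. *)
Inductive exec : prog -> state -> nat -> state -> Prop :=
| ExecSkip s : exec Skip s 1 s
| ExecNStore s a e1 e2 :
    exec (NStore a e1 e2) s (ncost e1 + ncost e2).+1
      (State (upd (nmem s) a (neval s e1) (neval s e2)) (rmem s))
| ExecRStore s a e1 e2 :
    exec (RStore a e1 e2) s (ncost e1 + rcost e2).+1
      (State (nmem s) (upd (rmem s) a (neval s e1) (reval s e2)))
| ExecSeq P1 P2 s1 t1 s2 t2 s3 :
    exec P1 s1 t1 s2 -> exec P2 s2 t2 s3 ->
    exec (Seq P1 P2) s1 (t1 + t2) s3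
| ExecIfTrue b P1 P2 s t s' :
    beval s b -> exec P1 s t s' -> exec (If b P1 P2) s (bcost b + t) s'
| ExecIfFalse b P1 P2 s t s' :
    ~~ beval s b -> exec P2 s t s' -> exec (If b P1 P2) s (bcost b + t) s'
| ExecWhileTrue b P s1 t1 s2 t2 s3 :
    beval s1 b -> exec P s1 t1 s2 -> exec (While b P) s2 t2 s3 ->
    exec (While b P) s1 (bcost b + t1 + t2) s3
| ExecWhileFalse b P s :
    ~~ beval s b -> exec (While b P) s (bcost b) s.

(* Input: m and n are the first two cells of natural array 0, the rewards of
   the vertices are in real array 0 in row-major order, the budget is the first
   cell of real array 1, and all other cells are 0. *)
Definition input_state (m n : nat) (r : vertex -> R) (B : R) : state :=
  State
    (fun a k => if a == 0%N then nth 0%N [:: m; n] k else 0%N)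
    (fun a k =>
       if a == 0%N then
         if (k < m * n.+2)%N then r ((k %/ n.+2).+1, k %% n.+2)%N else 0
       else if (a == 1%N) && (k == 0%N) then B else 0).

(* Output: the first cell of natural array 1 is the number of entries of the
   walk; the row and column of its k-th entry are in natural arrays 2 and 3. *)
Definition output_walk (s : state) : seq vertex :=
  [seq (nmem s 2 k, nmem s 3 k) | k <- iota 0 (nmem s 1 0)].

End Semantics.

(* Main.v *)
Require Import Defs.
From mathcomp Require Import all_boot all_order all_algebra.
From mathcomp Require Import boolp zify lra.
Set Implicit Arguments.
Unset Strict Implicit.
Unset Printing Implicit Defensive.
Import Order.TTheory GRing.Theory Num.Theory.

(* Let S be the set of rows whose interior is visited by a full-row closed walk
   and i the last row that it reaches.  The walk traverses every row of S from
   end to end, it crosses each of the n + 1 vertical cuts an even number of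
   times, and each of the i - 1 horizontal cuts at least twice; hence its cost is
   at least 2 (i - 1) + (n + 1) E, where E is |S| rounded up to an even number.
   Conversely a zigzag down to row i, crossing the rows of S on the way and row i
   once more if |S| is odd, attains this cost.  So it suffices to find, for each
   i, the best set of rows among 1 .. i that fits in the budget.  The number of
   rows that fit decreases with i, so a row that has been discarded never comes
   back: insert row i, then discard the worst row until the set fits.  With a
   tournament tree this takes O(m log m) steps in total; summing the rows,
   rounding the budget to a natural number and writing the walk take O(m n). *)

(** * Timed weakest preconditions *)

Section Wp.

Variable R : realType.
Implicit Types (s : state R) (P : prog) (Q : nat -> state R -> Prop).

(** The postcondition also receives the elapsed time. A loop cannot be unfolded by structural
    recursion, so its clause appeals to [exec]; invariants enter through [wp_while]. *)
Fixpoint wp P Q s : Prop :=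
  match P with
  | Skip => Q 1 s
  | NStore a e1 e2 => Q (ncost e1 + ncost e2).+1
      (State (upd (nmem s) a (neval s e1) (neval s e2)) (rmem s))
  | RStore a e1 e2 => Q (ncost e1 + rcost e2).+1
      (State (nmem s) (upd (rmem s) a (neval s e1) (reval s e2)))
  | Seq P1 P2 => wp P1 (fun t1 => wp P2 (fun t2 => Q (t1 + t2))) s
  | If b P1 P2 => if beval s b then wp P1 (fun t => Q (bcost b + t)) s
                  else wp P2 (fun t => Q (bcost b + t)) s
  | While b P1 => exists t s', exec (While b P1) s t s' /\ Q t s'
  end.

Lemma wp_seq P1 P2 Q s :
  wp P1 (fun t1 => wp P2 (fun t2 => Q (t1 + t2))) s -> wp (Seq P1 P2) Q s.
Proof. by []. Qed.

Lemma wp_nstore a e1 e2 Q s :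
  Q (ncost e1 + ncost e2).+1
    (State (upd (nmem s) a (neval s e1) (neval s e2)) (rmem s)) ->
  wp (NStore a e1 e2) Q s.
Proof. by []. Qed.

Lemma wp_if b P1 P2 Q s :
  (beval s b -> wp P1 (fun t => Q (bcost b + t)) s) ->
  (~~ beval s b -> wp P2 (fun t => Q (bcost b + t)) s) ->
  wp (If b P1 P2) Q s.
Proof. by move=> H1 H2 /=; case: ifPn. Qed.

Lemma wpP P Q s : wp P Q s <-> exists t s', exec P s t s' /\ Q t s'.
Proof.
elim: P Q s => [|a e1 e2|a e1 e2|P1 IH1 P2 IH2|b P1 IH1 P2 IH2|b P1 IH1] Q s /=.
- split=> [H|[t [s' [H]]]]; first by exists 1, s; split=> //; constructor.
  by inversion H.
- split=> [H|[t [s' [H]]]]; last by inversion H.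
  by eexists _, _; split; first by constructor.
- split=> [H|[t [s' [H]]]]; last by inversion H.
  by eexists _, _; split; first by constructor.
- split=> [/IH1[t1 [s1 [E1 /IH2[t2 [s2 [E2 H]]]]]]|[t [s' [H HQ]]]].
    by exists (t1 + t2), s2; split=> //; apply: ExecSeq E1 E2.
  inversion H as [| | |? ? ? t1 s1 t2 ? E1 E2| | | |]; subst.
  by apply/IH1; exists t1, s1; split=> //; apply/IH2; exists t2, s'.
- case: ifPn => Hb; split=> [|[t [s' [H HQ]]]].
  + move=> /IH1[t [s' [E H]]].
    by exists (bcost b + t), s'; split=> //; apply: ExecIfTrue.
  + inversion H as [| | | |? ? ? ? t1 ? Hb' E|? ? ? ? t1 ? Hb' E| |]; subst.
      by apply/IH1; exists t1, s'.
    by rewrite Hb in Hb'.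
  + move=> /IH2[t [s' [E H]]].
    by exists (bcost b + t), s'; split=> //; apply: ExecIfFalse.
  + inversion H as [| | | |? ? ? ? t1 ? Hb' E|? ? ? ? t1 ? Hb' E| |]; subst.
      by rewrite Hb' in Hb.
    by apply/IH2; exists t1, s'.
- by [].
Qed.

Fixpoint nwrites P : seq nat :=
  match P with
  | NStore a _ _ => [:: a]
  | Skip | RStore _ _ _ => [::]
  | Seq P1 P2 | If _ P1 P2 => nwrites P1 ++ nwrites P2
  | While _ P1 => nwrites P1
  end.

Fixpoint rwrites P : seq nat :=
  match P with
  | RStore a _ _ => [:: a]
  | Skip | NStore _ _ _ => [::]
  | Seq P1 P2 | If _ P1 P2 => rwrites P1 ++ rwrites P2
  | While _ P1 => rwrites P1
  end.

(** The arrays left alone are read off the program text, so each later use is settled by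
    computation. *)
Definition frame P s s' : Prop :=
  (forall a, a \notin nwrites P -> nmem s' a = nmem s a) /\
  (forall a, a \notin rwrites P -> rmem s' a = rmem s a).

Lemma exec_frame P s t s' : exec P s t s' -> frame P s s'.
Proof.
elim=> {P s t s'}
  [s|s a e1 e2|s a e1 e2|P1 P2 s1 t1 s2 t2 s3 _ [IH1 IH1'] _ [IH2 IH2']
  |b P1 P2 s t s' _ _ [IH IH']|b P1 P2 s t s' _ _ [IH IH']
  |b P s1 t1 s2 t2 s3 _ _ [IH1 IH1'] _ [IH2 IH2']|b P s _]; split=> //= a'.
- by rewrite inE => /negPf na; apply: funext => i; rewrite /upd na.
- by rewrite inE => /negPf na; apply: funext => i; rewrite /upd na.
- by rewrite mem_cat negb_or => /andP[n1 n2]; rewrite IH2 // IH1.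
- by rewrite mem_cat negb_or => /andP[n1 n2]; rewrite IH2' // IH1'.
- by rewrite mem_cat negb_or => /andP[n1 n2]; rewrite IH.
- by rewrite mem_cat negb_or => /andP[n1 n2]; rewrite IH'.
- by rewrite mem_cat negb_or => /andP[n1 n2]; rewrite IH.
- by rewrite mem_cat negb_or => /andP[n1 n2]; rewrite IH'.
- by move=> n1; rewrite IH2 // IH1.
- by move=> n1; rewrite IH2' // IH1'.
Qed.

Lemma wp_frame P Q s :
  wp P (fun t s' => frame P s s' -> Q t s') s -> wp P Q s.
Proof.
move=> /wpP[t [s' [E H]]]; apply/wpP; exists t, s'; split=> //.
exact: H (exec_frame E).
Qed.

Lemma frame_refl P s : frame P s s.
Proof. by []. Qed.

(* The potential [pot] is at once the termination measure and the time bound. *)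
Lemma wp_while b P (I : state R -> Prop) (pot : state R -> nat) Q s :
  I s ->
  (forall s1, frame P s s1 -> I s1 -> beval s1 b ->
     wp P (fun t s2 => I s2 /\ bcost b + t + pot s2 <= pot s1) s1) ->
  (forall t s1, frame P s s1 -> I s1 -> ~~ beval s1 b ->
     t + pot s1 <= pot s + bcost b -> Q t s1) ->
  wp (While b P) Q s.
Proof.
move=> Is Hstep HQ /=.
suff [t [s' [E [F Is' nb le_t]]]] : exists t s', exec (While b P) s t s' /\
    [/\ frame P s s', I s', ~~ beval s' b & t + pot s' <= pot s + bcost b].
  by exists t, s'; split=> //; apply: HQ.
(* The run is followed from an arbitrary intermediate state [s1], while the frame stays anchored at
   the initial state [s]. *)
have := frame_refl P s; move: {1 3 4 6}s Is => s1.
have [k] := ubnP (pot s1); elim: k s1 => // k IH s1 lek Is1 F1.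
(* A test costs at least one unit, so the potential decreases strictly. *)
have bpos : 0 < bcost b by case: (b).
case Hb: (beval s1 b); last first.
  exists (bcost b), s1; split; first by apply: ExecWhileFalse; rewrite Hb.
  by split=> //; rewrite ?Hb // addnC.
have /wpP[t [s2 [E [Is2 Ht]]]] := Hstep _ F1 Is1 Hb.
have F2 : frame P s s2.
  by have [H1 H2] := exec_frame E; split=> a na; rewrite ?H1 ?H2 // ?F1.1 ?F1.2.
have [|t' [s' [E' [F' Is' nb le_t]]]] := IH s2 _ Is2 F2; first by lia.
exists (bcost b + t + t'), s'; split; first exact: ExecWhileTrue E E'.
by split=> //; lia.
Qed.

End Wp.

(** * Lower bound on the cost of a full-row closed walk *)

Lemma ler_sum_subset (R : realType) (T : eqType) (f : T -> R) (s s' : seq T) :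
  uniq s -> uniq s' -> {subset s <= s'} ->
  (forall x, x \in s' -> x \notin s -> 0 <= f x)%R ->
  (\sum_(x <- s) f x <= \sum_(x <- s') f x)%R.
Proof.
move=> us us' sub f_ge0; rewrite [leRHS](bigID (mem s)) /=.
rewrite -[X in (_ <= X + _)%R]big_filter.
rewrite (perm_big [seq x <- s' | x \in s]) /=; last first.
  apply: uniq_perm; rewrite ?filter_uniq // => x; rewrite mem_filter.
  by case xs: (x \in s); rewrite ?(sub _ xs).
rewrite lerDl big_seq_cond; apply: sumr_ge0 => x /andP[]; exact: f_ge0.
Qed.

(** * Crossings of the horizontal and vertical cuts *)

Section Cuts.

Implicit Types (p : pred vertex) (q : seq vertex).

Definition steps x q : seq (vertex * vertex) := pairmap pair x q.

Definition crossings p x q := count (fun e => p e.1 != p e.2) (steps x q).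

(** Each crossing toggles [p], so only the two ends matter; on a closed walk the number is even. *)
Lemma odd_crossings p x q : odd (crossings p x q) = p x (+) p (last x q).
Proof.
elim: q x => [|y q IH] x; rewrite /crossings /= ?addbb // oddD -/(crossings p y q).
by rewrite IH; case: (p x) (p y) (p (last y q)) => [] [] [].
Qed.

Lemma crossings_gt0 p x y q :
  y \in x :: q -> p y != p x -> 0 < crossings p x q.
Proof.
elim: q x => [|z q IH] x; first by rewrite inE => /eqP-> /eqP.
rewrite /crossings /= -/(crossings p z q) inE => /orP[/eqP->|yzq] pyx.
  by rewrite eqxx in pyx.
case pxz: (p x == p z) => //=.
by rewrite add0n; apply: IH => //; rewrite -(eqP pxz).
Qed.

Lemma steps_nth x q k : k < size q ->
  (nth (0, 0) (x :: q) k, nth (0, 0) (x :: q) k.+1) \in steps x q.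
Proof.
move=> ltk; apply/(nthP ((0, 0), (0, 0))); exists k; rewrite ?size_pairmap //.
by rewrite (nth_pairmap (0, 0)).
Qed.

Lemma sum_cut_le1 (s : seq nat) (a b : nat) :
  uniq s -> b = a.+1 \/ a = b.+1 ->
  \sum_(c <- s) ((a <= c) != (b <= c) : nat) <= 1.
Proof.
move=> us ab; rewrite (eq_bigr (fun c => (c == minn a b : nat))); last first.
  by move=> c _; congr nat_of_bool; lia.
by rewrite -big_mkcond /= sum1_count count_uniq_mem // leq_b1.
Qed.

(** An edge changes one coordinate, by one, and therefore crosses at most one of all these cuts; no
    step is counted twice. *)
Lemma sum_crossings_le m n x q (rs cs : seq nat) :
  uniq rs -> uniq cs -> path (aisle_edge m n) x q ->
  \sum_(c <- cs) crossings (fun v => v.2 <= c) x q +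
  \sum_(i <- rs) crossings (fun v => v.1 <= i) x q <= size q.
Proof.
move=> urs ucs; elim: q x => [|y q IH] x /=; first by rewrite !big1_eq.
case/andP=> xy /IH{}IH; rewrite /crossings /=.
rewrite !big_split /= addnACA -[(size q).+1]add1n; apply: leq_add IH.
have [[E H]|[E H]] : (x.1 = y.1 /\ (y.2 = x.2.+1 \/ x.2 = y.2.+1)) \/
          (x.2 = y.2 /\ (y.1 = x.1.+1 \/ x.1 = y.1.+1)).
- by move: xy; rewrite /aisle_edge /aisle_arc; lia.
- rewrite [X in _ + X]big1 ?addn0; first exact: sum_cut_le1.
  by move=> i _; rewrite E eqxx.
- rewrite [X in X + _]big1 ?add0n; first exact: sum_cut_le1.
  by move=> i _; rewrite E eqxx.
Qed.

End Cuts.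

(** * Rows traversed by a full-row closed walk *)

Section FullRowWalk.

Variables (m n : nat) (w : seq vertex).
Hypotheses (cw : closed_walk m n (1, 0) w) (fw : full_row n w).

Definition inner_visit (j : nat) : bool :=
  has (fun v => (v.1 == j) && (1 <= v.2 <= n)) w.

Definition visited_rows : seq nat := [seq j <- iota 1 m | inner_visit j].

Lemma closed_walkP : exists2 q, w = (1, 0) :: q &
  [/\ aisle_vertex m n (1, 0), path (aisle_edge m n) (1, 0) q
   & last (1, 0) q = (1, 0)].
Proof.
move: cw; case: w => //= x q /and4P[/eqP-> ? ? /eqP ?]; by exists q.
Qed.

Lemma mem_walk v : v \in w -> aisle_vertex m n v.
Proof.
have [q -> [v0 + _]] := closed_walkP; rewrite inE => pq /orP[/eqP->//|].
elim: q (1, 0) pq v0 => //= y q IH x /andP[xy pq] v0.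
have vy : aisle_vertex m n y by case/orP: xy => /and3P[].
by rewrite inE => /orP[/eqP->//|]; apply: IH pq vy.
Qed.

(** Both ends of the walk lie in column 0, so an inner visit has a step before and a step after it.
    There are no vertical edges in inner columns, and not reversing puts the two neighbours on
    opposite sides. *)
Lemma inner_neighbours j c : (j, c) \in w -> 1 <= c <= n ->
  exists k, let u := nth (0, 0) w k in let v := nth (0, 0) w k.+2 in
  [/\ k.+2 < size w, nth (0, 0) w k.+1 = (j, c) &
   (u = (j, c.-1) /\ v = (j, c.+1)) \/ (u = (j, c.+1) /\ v = (j, c.-1))].
Proof.
move=> jcw cn; have [q Ew [v0 pq lq]] := closed_walkP.
have /(nthP (0, 0))[k ltk Ek] := jcw.
case: k ltk Ek => [_|k ltk Ek]; first by rewrite Ew => -[_ c0]; rewrite -c0 in cn.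
have ltk2 : k.+2 < size w.
  rewrite ltn_neqAle ltk andbT; apply/eqP => Ek2.
  have : last (0, 0) w = (1, 0) by rewrite Ew.
  by rewrite -nth_last -Ek2 /= Ek => -[_ c0]; rewrite c0 in cn.
exists k; split=> //.
have e1 : aisle_edge m n (nth (0, 0) w k) (nth (0, 0) w k.+1).
  by move: ltk ltk2; rewrite Ew /= => ltk ltk2; apply: (pathP _ pq).
have e2 : aisle_edge m n (nth (0, 0) w k.+1) (nth (0, 0) w k.+2).
  by move: ltk ltk2; rewrite Ew /= => ltk ltk2; apply: (pathP _ pq).
have := fw ltk2; move: e1 e2; rewrite Ek /= => e1 e2 /(_ cn) ne.
case: (nth _ _ k) (nth _ _ k.+2) e1 e2 ne => [a b] [a' b'].
rewrite /aisle_edge /aisle_arc /= => e1 e2 ne.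
have {}ne : ~ (a' = a /\ b' = b) by move=> [E1 E2]; apply: ne; rewrite E1 E2.
have [[-> [-> [-> ->]]]|[-> [-> [-> ->]]]] :
  (a = j /\ b = c.-1 /\ a' = j /\ b' = c.+1) \/
  (a = j /\ b = c.+1 /\ a' = j /\ b' = c.-1); first by lia.
- by left.
- by right.
Qed.

Lemma inner_row_visited j c c' :
  (j, c) \in w -> 1 <= c <= n -> 1 <= c' <= n -> (j, c') \in w.
Proof.
have nb c1 : (j, c1) \in w -> 1 <= c1 <= n ->
    (j, c1.+1) \in w /\ (j, c1.-1) \in w.
  move=> H1 H2; have [k [ltk _ [] []]] := inner_neighbours H1 H2 => <- <-;
  by split; apply: mem_nth; apply: leq_trans ltk; lia.
have up d c1 : (j, c1) \in w -> 1 <= c1 -> c1 + d <= n -> (j, c1 + d) \in w.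
  elim: d => [|d IH] H1 H2 H3; first by rewrite addn0.
  by rewrite addnS; apply: (proj1 (nb _ _ _)); [apply: IH => //|]; lia.
have dn d c1 : (j, c1) \in w -> c1 <= n -> d < c1 -> (j, c1 - d) \in w.
  elim: d => [|d IH] H1 H2 H3; first by rewrite subn0.
  by rewrite subnS; apply: (proj2 (nb _ _ _)); [apply: IH => //|]; lia.
move=> H1 H2 H3; have [le|lt] := leqP c c'.
  by rewrite -(subnKC le); apply: up => //; lia.
by rewrite -(subKn (ltnW lt)); apply: dn => //; lia.
Qed.

Lemma row_crosses_column j c : 0 < n -> inner_visit j -> c <= n ->
  exists2 e, e \in steps (1, 0) (behead w) &
    ((e.1.2 <= c) != (e.2.2 <= c)) && (e.1.1 == j).
Proof.
move=> n0 /hasP[[j' c'] jw /= /andP[/eqP Ej c'n]] cn; rewrite {}Ej in jw.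
have [q Ew _] := closed_walkP.
(* Both horizontal edges at this vertex are walked, and one of them crosses the cut after column
   [c]. The maximum treats [c = 0], where column [c] itself is not inner. *)
have jc1 : (j, maxn 1 c) \in w by apply: inner_row_visited jw _ _; lia.
have mx : 1 <= maxn 1 c <= n by lia.
have [k []] := inner_neighbours jc1 mx.
rewrite {1}Ew /= => ltk Ek Ekk.
have s1 : (nth (0, 0) w k, nth (0, 0) w k.+1) \in steps (1, 0) (behead w).
  by rewrite Ew; apply: steps_nth; lia.
have s2 : (nth (0, 0) w k.+1, nth (0, 0) w k.+2) \in steps (1, 0) (behead w).
  by rewrite Ew; apply: steps_nth; lia.
case: Ekk => -[E1 E2]; case: (posnP c) => c0.
- by exists (nth (0, 0) w k, nth (0, 0) w k.+1); rewrite // E1 Ek /=; lia.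
- by exists (nth (0, 0) w k.+1, nth (0, 0) w k.+2); rewrite // E2 Ek /=; lia.
- by exists (nth (0, 0) w k.+1, nth (0, 0) w k.+2); rewrite // E2 Ek /=; lia.
- by exists (nth (0, 0) w k, nth (0, 0) w k.+1); rewrite // E1 Ek /=; lia.
Qed.

Definition max_row : nat := \max_(v <- w) v.1.

Lemma visited_rows_le_max : {subset visited_rows <= iota 1 max_row}.
Proof.
move=> j; rewrite mem_filter => /andP[/hasP[v vw /andP[/eqP <- _]]].
rewrite !mem_iota => /andP[v1 _]; rewrite v1 /= add1n ltnS.
exact: (@leq_bigmax_seq _ _ _ (fun v : vertex => v.1)).
Qed.

Lemma max_row_bounds : 1 <= max_row <= m.
Proof.
have [q Ew _] := closed_walkP; apply/andP; split.
  apply: (@leq_trans (1, 0).1) => //.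
  by apply: (@leq_bigmax_seq _ _ _ (fun v : vertex => v.1)); rewrite // Ew mem_head.
apply/bigmax_leqP_seq => v vw _; have := mem_walk vw.
by rewrite /aisle_vertex => /andP[/andP[]].
Qed.

Lemma full_row_cost : 0 < n ->
  (uphalf (size visited_rows)).*2 * n.+1 + (max_row.-1).*2 <= walk_cost w.
Proof.
move=> n0; have [q Ew [v0 pq lq]] := closed_walkP.
have := sum_crossings_le (iota_uniq 1 max_row.-1) (iota_uniq 0 n.+1) pq.
have -> : walk_cost w = size q by rewrite /walk_cost Ew.
apply: leq_trans; apply: leq_add.
  have -> : (uphalf (size visited_rows)).*2 * n.+1 =
      \sum_(c <- iota 0 n.+1) (uphalf (size visited_rows)).*2.
    by rewrite big_const_seq count_predT size_iota iter_addn_0.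
  rewrite big_seq [leqRHS]big_seq; apply: leq_sum => c; rewrite mem_iota => cn.
  have ev : ~~ odd (crossings (fun v => v.2 <= c) (1, 0) q).
    by rewrite odd_crossings lq addbb.
  (* Evenness rounds the lower bound up. *)
  suff le : size visited_rows <= crossings (fun v => v.2 <= c) (1, 0) q by lia.
  rewrite /crossings -size_filter.
  (* Sending a crossing step to its row shows that distinct rows supply distinct crossings. *)
  rewrite -(size_map (fun e : vertex * vertex => e.1.1)).
  apply: uniq_leq_size; first by rewrite filter_uniq ?iota_uniq.
  move=> j; rewrite mem_filter => /andP[vj _].
  have cn' : c <= n by lia.
  have [e] := row_crosses_column n0 vj cn'; rewrite Ew /= => ein /andP[ce /eqP <-].
  by apply: map_f; rewrite mem_filter ce.
have -> : max_row.-1.*2 = \sum_(i <- iota 1 max_row.-1) 2.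
  by rewrite big_const_seq count_predT size_iota iter_addn_0 mul2n.
rewrite big_seq [leqRHS]big_seq; apply: leq_sum => i; rewrite mem_iota => ib.
have ev : ~~ odd (crossings (fun v => v.1 <= i) (1, 0) q).
  by rewrite odd_crossings lq addbb.
suff : 0 < crossings (fun v => v.1 <= i) (1, 0) q by lia.
have [v vw lt] : exists2 v, v \in w & i < v.1.
  apply/hasP; rewrite -[has _ _]negbK -all_predC; apply/negP => /allP al.
  suff : max_row <= i by lia.
  by apply/bigmax_leqP_seq => v vw _; have /= := al _ vw; rewrite -leqNgt.
apply: (@crossings_gt0 _ _ v); first by rewrite -Ew.
by rewrite /= leqNgt lt /=; case: i ib {ev lt}.
Qed.

End FullRowWalk.

(** * Rewards collected row by row *)

Section Rewards.

Variables (R : realType) (m n : nat) (r : vertex -> R).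
Hypothesis hr : aisle_reward m n r.

Definition row_reward (j : nat) : R := (\sum_(0 <= c < n.+2) r (j, c))%R.

Definition row_vertices (S : seq nat) : seq vertex :=
  [seq (j, c) | j <- S, c <- index_iota 0 n.+2].

Lemma row_vertices_uniq S : uniq S -> uniq (row_vertices S).
Proof.
by move=> uS; apply: allpairs_uniq; rewrite ?iota_uniq // => -[? ?] [? ?].
Qed.

Lemma mem_row_vertices S j c :
  ((j, c) \in row_vertices S) = (j \in S) && (c < n.+2).
Proof.
apply/allpairsP/andP => [[[a b] [/= aS bi [-> ->]]]|[jS cn]].
  by rewrite aS; move: bi; rewrite mem_index_iota.
by exists (j, c); rewrite mem_index_iota.
Qed.

Lemma sum_row_vertices S :
  (\sum_(v <- row_vertices S) r v = \sum_(j <- S) row_reward j)%R.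
Proof. by rewrite big_allpairs. Qed.

Lemma row_reward_ge0 j : 1 <= j <= m -> (0 <= row_reward j)%R.
Proof.
move=> jm; rewrite /row_reward big_seq; apply: sumr_ge0 => c.
rewrite mem_index_iota => cn; case: hr => r0 _ _; apply: r0.
by rewrite /aisle_vertex /=; lia.
Qed.

(** The end columns contribute zero, and every other visited vertex lies in a row of
    [visited_rows]. *)
Lemma walk_reward_le w : closed_walk m n (1, 0) w ->
  (walk_reward r w <= \sum_(j <- visited_rows m n w) row_reward j)%R.
Proof.
move=> cw; have [r0 rl rr] := hr.
rewrite -sum_row_vertices /walk_reward.
rewrite (bigID (fun v : vertex => 1 <= v.2 <= n)) /= [X in (_ + X)%R]big1_seq ?addr0.
  rewrite -big_filter; apply: ler_sum_subset.
  - by rewrite filter_uniq ?undup_uniq.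
  - by apply: row_vertices_uniq; rewrite filter_uniq ?iota_uniq.
  - move=> [j c]; rewrite mem_filter mem_undup /= => /andP[cn jw].
    rewrite mem_row_vertices mem_filter mem_iota.
    have := mem_walk cw jw; rewrite /aisle_vertex /= => va.
    apply/andP; split; last by lia.
    apply/andP; split; last by lia.
    by apply/hasP; exists (j, c); rewrite //= eqxx.
  - move=> [j c]; rewrite mem_row_vertices mem_filter mem_iota => H _.
    by apply: r0; rewrite /aisle_vertex /=; lia.
move=> [j c]; rewrite mem_undup /= => /andP[cn /(mem_walk cw)].
rewrite /aisle_vertex /= => va.
have [->|->] : c = 0 \/ c = n.+1 by lia.
  by apply: rl; lia.
by apply: rr; lia.
Qed.

Lemma walk_reward_ge w S : closed_walk m n (1, 0) w -> uniq S ->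
  {subset row_vertices S <= w} ->
  (\sum_(j <- S) row_reward j <= walk_reward r w)%R.
Proof.
move=> cw uS sub; have [r0 _ _] := hr.
rewrite -sum_row_vertices /walk_reward; apply: ler_sum_subset.
- exact: row_vertices_uniq.
- exact: undup_uniq.
- by move=> v /sub; rewrite mem_undup.
- by move=> v; rewrite mem_undup => /(mem_walk cw) /r0.
Qed.

End Rewards.

(** * Greedy choice of the rows *)

Section Greedy.

Variables (R : realType) (n b : nat) (f : nat -> R).
Implicit Types (A S : seq nat) (d : nat -> nat).

(* [2 (i - 1)] is written [i.*2] on the left and [2] on the right. *)
Definition fits (k i : nat) : bool := (uphalf k).*2 * n.+1 + i.*2 <= b.+2.

Lemma fits_leq k k' i i' : k <= k' -> i <= i' -> fits k' i' -> fits k i.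
Proof.
rewrite /fits => lek lei; apply: leq_trans; apply: leq_add; last by lia.
by rewrite leq_mul2r leq_double uphalf_leq ?orbT.
Qed.

Definition top_rows i A : Prop := forall j a,
  j \in iota 1 i -> j \notin A -> a \in A -> (f j <= f a)%R.

Definition least_in A x : Prop :=
  x \in A /\ forall a, a \in A -> (f x <= f a)%R.

(* The third alternative describes the moment after an insertion, when the new
   row may be worse than the discarded ones; it is then the one to go. *)
Definition greedy i A : Prop :=
  [\/ A = iota 1 i, top_rows i A /\ ~~ fits (size A).+1 i
    | ~~ fits (size A) i /\ forall x, least_in A x -> top_rows i (rem x A)].

Lemma top_rows_rem i A x : uniq A -> top_rows i A -> least_in A x ->
  top_rows i (rem x A).
Proof.
move=> uA tA [xA minx] j a ji; rewrite !mem_rem_uniq // !inE negb_and negbK.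
by case/orP=> [/eqP->|jA] /andP[_ aA]; [apply: minx|apply: tA].
Qed.

(** Putting a row back would restore a size that does not fit, so the second alternative holds
    afterwards. The set of all rows consists of top rows vacuously, and the third alternative is
    made for this removal. *)
Lemma greedy_rem i A x : uniq A -> greedy i A -> ~~ fits (size A) i ->
  least_in A x -> greedy i (rem x A).
Proof.
move=> uA gA nf mx; have [xA minx] := mx.
have nf' : ~~ fits (size (rem x A)).+1 i.
  by rewrite size_rem // prednK //; case: (A) xA.
apply: Or32; split=> //; case: gA => [EA|[tA _]|[_]]; last exact.
  by apply: top_rows_rem => //; move=> j a ji; rewrite EA ji.
exact: top_rows_rem.
Qed.

Lemma iota1S i : iota 1 i.+1 = rcons (iota 1 i) i.+1.
Proof. by rewrite -{1}(addn1 i) iotaD /= cats1 add1n. Qed.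

Lemma rcons_iota1 j : 0 < j -> rcons (iota 1 j.-1) j = iota 1 j.
Proof. by case: j => // j _; rewrite iota1S. Qed.

(** If one more row did not fit at stage [i], it does not fit at stage [i.+1] either. If the least
    row is the new one, its removal gives back the old set; otherwise the least row is an old one,
    at least as good as every discarded row and no better than the new row. *)
Lemma greedy_insert i A : {subset A <= iota 1 i} -> uniq A ->
  greedy i A -> fits (size A) i -> greedy i.+1 (rcons A i.+1).
Proof.
move=> sA uA [->|[tA nf]|[nf _]] fA; last by rewrite fA in nf.
  by apply: Or31; rewrite iota1S.
have iA : i.+1 \notin A by apply/negP => /sA; rewrite mem_iota; lia.
apply: Or33; split.
  by rewrite size_rcons; apply: contra nf; apply: fits_leq.
move=> x [xA minx] j a.
rewrite mem_rem_uniq ?rcons_uniq ?iA // mem_rem_uniq ?rcons_uniq ?iA //.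
rewrite iota1S !inE !mem_rcons !inE negb_and negbK => ji jx /andP[ax aA].
case: (eqVneq j x) jx => [-> _|jx /= ]; first by apply: minx; rewrite mem_rcons.
rewrite negb_or => /andP[/negPf ji1 jA]; rewrite ji1 /= in ji.
case/orP: aA => [/eqP Ea|aA]; last exact: tA.
rewrite mem_rcons inE in xA; case/orP: xA => [/eqP Ex|xA].
  by rewrite Ea Ex eqxx in ax.
apply: (@le_trans _ _ (f x)); first exact: tA.
by rewrite Ea; apply: minx; rewrite mem_rcons mem_head.
Qed.

(** The entries are paired off in order; the surplus of [A] is nonnegative. *)
Lemma ler_sum_seq2 (S A : seq nat) : size S <= size A ->
  (forall x y, x \in S -> y \in A -> f x <= f y)%R ->
  (forall y, y \in A -> 0 <= f y)%R ->
  (\sum_(x <- S) f x <= \sum_(y <- A) f y)%R.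
Proof.
elim: S A => [|x S IH] [|y A] //= lesz lef f0.
- by rewrite big_nil big_seq; apply: sumr_ge0.
rewrite !big_cons; apply: lerD; first by apply: lef; rewrite mem_head.
apply: IH => // [u v uS vA|v vA]; last by apply: f0; rewrite inE vA orbT.
by apply: lef; rewrite inE ?uS ?vA orbT.
Qed.

(** An exchange argument: the common rows cancel, [S] has at most as many remaining rows as [A], and
    each of them is worth at most any remaining row of [A]. *)
Lemma greedy_optimal i A S :
  (forall j, j \in iota 1 i -> 0 <= f j)%R ->
  {subset A <= iota 1 i} -> uniq A -> greedy i A -> fits (size A) i ->
  {subset S <= iota 1 i} -> uniq S -> fits (size S) i ->
  (\sum_(j <- S) f j <= \sum_(j <- A) f j)%R.
Proof.
move=> f0 sA uA gA fA sS uS fS; case: gA => [EA|[tA nf]|[nf _]]; last first.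
- by rewrite fA in nf.
- have leSA : size S <= size A.
    by rewrite leqNgt; apply: contra nf => lt; apply: fits_leq fS.
  rewrite [leLHS](bigID (mem A)) [leRHS](bigID (mem S)) /=.
  rewrite -[X in (X + _ <= _)%R]big_filter -[X in (_ + X <= _)%R]big_filter.
  rewrite -[X in (_ <= X + _)%R]big_filter -[X in (_ <= _ + X)%R]big_filter.
  have E : perm_eq [seq j <- S | j \in A] [seq j <- A | j \in S].
    apply: uniq_perm; rewrite ?filter_uniq // => j.
    by rewrite !mem_filter andbC.
  rewrite (perm_big _ E) lerD2l; apply: ler_sum_seq2.
  - have e1 : size [seq j <- S | j \in A] + size [seq j <- S | j \notin A] = size S.
      by rewrite !size_filter; apply: (count_predC (mem A)).
    have e2 : size [seq j <- A | j \in S] + size [seq j <- A | j \notin S] = size A.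
      by rewrite !size_filter; apply: (count_predC (mem S)).
    by move: leSA; rewrite -e1 -e2 (perm_size E) leq_add2l.
  - move=> x y; rewrite !mem_filter => /andP[xA xS] /andP[yS yA].
    by apply: tA => //; apply: sS.
  - by move=> y; rewrite mem_filter => /andP[_ /sA]; apply: f0.
- apply: ler_sum_subset => // [j|j jA _]; first by rewrite EA; apply: sS.
  by apply: f0; apply: sA.
Qed.

(* Row [j] is discarded at stage [d j], where [0] stands for never. *)
Definition active d i : seq nat := [seq j <- iota 1 i | d j == 0].

(** The row set as it stood at the end of stage [i], recovered from the final discard times: rows
    discarded later still count. *)
Definition active_at d i : seq nat := [seq j <- iota 1 i | ~~ (1 <= d j <= i)].

Lemma active_uniq d i : uniq (active d i).
Proof. by rewrite filter_uniq ?iota_uniq. Qed.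

Lemma active_sub d i : {subset active d i <= iota 1 i}.
Proof. exact: mem_subseq (filter_subseq _ _). Qed.

Lemma active_insert d i : d i.+1 = 0 -> active d i.+1 = rcons (active d i) i.+1.
Proof. by move=> d0; rewrite /active iota1S filter_rcons d0 eqxx. Qed.

Lemma active_rem d d' x i : 0 < d' x -> (forall j, j != x -> d' j = d j) ->
  active d' i = rem x (active d i).
Proof.
move=> dx dne; rewrite rem_filter ?active_uniq // /active -filter_predI.
apply: eq_filter => j /=; case: (eqVneq j x) => [->|/dne->//].
by rewrite -[LHS]negbK -lt0n dx.
Qed.

Lemma active_atE d i : (forall j, d j <= i) -> active_at d i = active d i.
Proof. by move=> di; apply: eq_filter => j; have := di j; lia. Qed.

End Greedy.

(** * Tournament trees *)

Section Tournament.

Variables (R : realType) (f : nat -> R).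

(* The entry [0] marks an empty subtree and loses every match. *)
Definition beats (x y : nat) : bool := (y == 0) || (x != 0) && (f x <= f y)%R.

Lemma beats_total x y : ~~ beats x y -> beats y x.
Proof.
rewrite /beats; case: eqP => //= ny; case: eqP => //= nx.
by rewrite -ltNge => /ltW.
Qed.

Lemma beats_refl x : beats x x.
Proof. by rewrite /beats lexx andbT orbN. Qed.

Lemma beats_trans y x z : beats x y -> beats y z -> beats x z.
Proof.
rewrite /beats; case: (eqVneq z 0) => //= nz.
case: (eqVneq y 0) => //= ny /andP[-> xy] yz /=; exact: le_trans yz.
Qed.

(** Heap numbering: node [v] has children [v.*2] and [v.*2.+1], the matches are [1 .. m-1] and the
    leaves [m .. 2m-1]. This works for every [m], not only for powers of two. *)
Definition match_won (w : nat -> nat) (v : nat) : Prop :=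
  w v = if beats (w v.*2) (w v.*2.+1) then w v.*2 else w v.*2.+1.

Variables (m : nat) (w : nat -> nat).
Hypothesis won : forall v, 1 <= v < m -> match_won w v.

Lemma parent_beats v : 1 <= v < m -> beats (w v) (w v.*2) /\ beats (w v) (w v.*2.+1).
Proof.
move/won; rewrite /match_won; case: ifPn => H ->; split=> //; try exact: beats_refl.
exact: beats_total.
Qed.

Lemma root_beats v : 1 <= v < m.*2 -> beats (w 1) (w v).
Proof.
have [k] := ubnP v; elim: k v => // k IH v lek vm.
have [->|v1] := eqVneq v 1; first exact: beats_refl.
have h1 : 1 <= v./2 < m by lia.
have [H1 H2] := parent_beats h1.
apply: (@beats_trans (w v./2)); first by apply: IH; lia.
have [E|E] : v = v./2.*2 \/ v = v./2.*2.+1 by lia.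
  by rewrite {2}E.
by rewrite {2}E.
Qed.

(** Following the winner downwards increases the index until a leaf is reached. *)
Lemma node_from_leaf v : 1 <= v < m.*2 -> exists2 l, m <= l < m.*2 & w l = w v.
Proof.
have [k] := ubnP (m.*2 - v); elim: k v => // k IH v lek vm.
have [le|lt] := leqP m v; first by exists v => //; lia.
have := won (v := v); rewrite /match_won => -> //; last by lia.
by case: ifP => _; apply: IH; lia.
Qed.

(** The root beats every leaf, so it is nonzero once [A] is nonempty; it also equals some leaf, and
    a nonzero leaf is an element of [A]. *)
Lemma root_least (A : seq nat) : 0 < m -> {subset A <= iota 1 m} -> 0 < size A ->
  (forall j, j \in iota 1 m -> w (m + j).-1 = if j \in A then j else 0) ->
  least_in f A (w 1).
Proof.
move=> m0 sA A0 lf.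
have bt a : a \in A -> (w 1 != 0) && (f (w 1) <= f a)%R.
  move=> aA; have am := sA _ aA; have := lf a am; rewrite aA => Ea.
  rewrite mem_iota in am; have : 1 <= (m + a).-1 < m.*2 by lia.
  by move/root_beats; rewrite Ea /beats; case: eqP am => // ->.
split; last by move=> a /bt/andP[].
have : 1 <= 1 < m.*2 by lia.
move=> /node_from_leaf[l lm El].
have jm : l.+1 - m \in iota 1 m by rewrite mem_iota; lia.
have := lf _ jm; have -> : (m + (l.+1 - m)).-1 = l by lia.
rewrite El; case: ifP => [H ->//|_ w0].
by case: (A) A0 bt => // a A' _ /(_ a (mem_head _ _)); rewrite w0.
Qed.

End Tournament.

(** * The program *)

(* Natural arrays: 8 the cost of crossing k rows and returning to the left
   side, 9 the halves, 10 the stage at which a row is discarded, 11 the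
   tournament tree (row j is the leaf m + j - 1).  Real arrays: 2 the rewards of
   the rows, 3 the real copy of the rounded budget, 4 the reward of the current
   rows, 5 the best reward found. The scalars below live in cell 0. *)
Local Notation "P ;; Q" := (Seq P Q) (at level 61, right associativity).
Local Notation "e1 '+n' e2" := (NAdd e1 e2) (at level 50, left associativity).
Local Notation cst := NConst.
Local Notation var a := (NLoad a (NConst 0)).
Local Notation set a e := (NStore a (NConst 0) e).
Local Notation m_ := (NLoad 0 (NConst 0)).
Local Notation n_ := (NLoad 0 (NConst 1)).
Local Notation j_ := 4.
Local Notation k_ := 5.
Local Notation c_ := 6.
Local Notation b_ := 7.
Local Notation u_ := 12.
Local Notation i_ := 13.
Local Notation sz_ := 14.
Local Notation bi_ := 15.

(** Naturals cannot be multiplied on this machine, so the address [k_] simply advances through the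
    row-major input across all rows. *)
Definition sum_row : prog :=
  While (BLeN (var c_ +n cst 1) (n_ +n cst 2))
    (RStore 2 (var j_ +n cst 1)
       (RAdd (RLoad 2 (var j_ +n cst 1)) (RLoad 0 (var k_)));;
     set k_ (var k_ +n cst 1);;
     set c_ (var c_ +n cst 1)).

Definition sum_rows : prog :=
  While (BLeN (var j_ +n cst 1) m_)
    (set c_ (cst 0);; sum_row;; set j_ (var j_ +n cst 1)).

(** Rounding by counting. The previous loop leaves [m * n.+2] in [k_]; twice this number caps the
    count and with it the running time for huge budgets. *)
Definition floor_budget : prog :=
  While (BAnd (BLeN (var b_ +n cst 1) (var k_ +n var k_))
              (BLeR (RAdd (RLoad 3 (cst 0)) ROne) (RLoad 1 (cst 0))))
    (set b_ (var b_ +n cst 1);; RStore 3 (cst 0) (RAdd (RLoad 3 (cst 0)) ROne)).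

(** Two more rows cost [2 (n + 1)] more, which replaces a multiplication by a recurrence. *)
Definition cost_table : prog :=
  NStore 8 (cst 1) (n_ +n n_ +n cst 2);;
  set j_ (cst 0);;
  While (BLeN (var j_ +n cst 1) m_)
    (NStore 8 (var j_ +n cst 2) (NLoad 8 (var j_) +n (n_ +n n_ +n cst 2));;
     set j_ (var j_ +n cst 1)).

(** Division is tabulated as well; these halves give the parents in the tournament tree. *)
Definition half_table : prog :=
  set j_ (cst 1);;
  While (BLeN (var j_ +n cst 1) m_)
    (NStore 9 (var j_ +n var j_) (var j_);;
     NStore 9 (var j_ +n var j_ +n cst 1) (var j_);;
     set j_ (var j_ +n cst 1)).

(** * Correctness and running time of the tabulation loops *)

Section TableSpec.

Variables (R : realType) (m n : nat) (r : vertex -> R) (B : R).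
Implicit Types (s : state R) (Q : nat -> state R -> Prop).

Lemma sum_row_spec Q s j :
  j < m -> nmem s 0 1 = n -> rmem s 0 = rmem (input_state m n r B) 0 ->
  nmem s j_ 0 = j -> nmem s k_ 0 = j * n.+2 -> nmem s c_ 0 = 0 ->
  rmem s 2 j.+1 = 0%R ->
  (forall t s', frame sum_row s s' -> t <= 60 * n.+3 ->
     nmem s' k_ 0 = j.+1 * n.+2 -> rmem s' 2 j.+1 = row_reward n r j.+1 ->
     (forall j', j' != j.+1 -> rmem s' 2 j' = rmem s 2 j') -> Q t s') ->
  wp sum_row Q s.
Proof.
move=> jm En E0 Ej Ek Ec E2 HQ.
apply: (wp_while (I := fun s1 => exists2 c, c <= n.+2 &
   [/\ nmem s1 c_ 0 = c, nmem s1 k_ 0 = j * n.+2 + c,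
       rmem s1 2 j.+1 = (\sum_(0 <= c' < c) r (j.+1, c'))%R &
       forall j', j' != j.+1 -> rmem s1 2 j' = rmem s 2 j'])
  (pot := fun s1 => 60 * (n.+2 - nmem s1 c_ 0))).
- by exists 0 => //; split; rewrite ?Ek ?addn0 // big_geq.
- move=> s1 [F G] [c cn [Ec1 Ek1 E21 E2']]; have Ej1 := F j_ isT; have En1 := F 0 isT.
  have E01 := G 0 isT; rewrite /= Ec1 En1 En Ej1 Ej E01 E0 Ek1 !addn1 addn2 => ltc.
  split; last by rewrite /upd /=; lia.
  exists c.+1 => //; split=> //; rewrite /upd /= ?Ec1 ?addnS //.
    (* The address lies inside the reward array and decodes to the vertex [(j.+1, c)]. *)
    have lt : j * n.+2 + c < m * n.+2.
      rewrite (@leq_trans (j.+1 * n.+2)) ?leq_mul2r ?jm ?orbT //.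
      by rewrite mulSn addnC ltn_add2r.
    rewrite eqxx lt E21 big_nat_recr //= divnMDl // divn_small // addn0.
    by rewrite modnMDl modn_small.
  by move=> j' nj; rewrite (negPf nj); apply: E2'.
- move=> t s1 FG [c cn [Ec1 Ek1 E21 E2']]; have [F G] := FG.
  rewrite /= Ec1 F // En addn2 addn1 => nlt le_t.
  have Ec' : c = n.+2 by lia.
  apply: HQ => //; first by move: le_t; rewrite Ec; lia.
  - by rewrite Ek1 Ec' mulSn addnC.
  - by rewrite E21 Ec'.
Qed.

Lemma sum_rows_spec Q :
  (forall t s', frame sum_rows (input_state m n r B) s' ->
     t <= m * (60 * n.+3 + 60) + 60 -> nmem s' k_ 0 = m * n.+2 ->
     (forall j, 1 <= j <= m -> rmem s' 2 j = row_reward n r j) -> Q t s') ->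
  wp sum_rows Q (input_state m n r B).
Proof.
move=> HQ; set s := input_state m n r B in HQ *.
apply: (wp_while (I := fun s1 => exists2 j, j <= m &
   [/\ nmem s1 j_ 0 = j, nmem s1 k_ 0 = j * n.+2,
       (forall j', 1 <= j' <= j -> rmem s1 2 j' = row_reward n r j') &
       forall j', j < j' -> rmem s1 2 j' = 0%R])
  (pot := fun s1 => (m - nmem s1 j_ 0) * (60 * n.+3 + 60))).
- by exists 0 => //; split=> //; lia.
- move=> s1 [F G] [j jm [Ej Ek E2 E20]]; rewrite /= Ej F //= addn1 => ltj.
  have En1 := F 0 isT; have E01 := G 0 isT.
  apply: (@sum_row_spec _ _ j); rewrite /upd /= ?En1 ?E01 //; first exact: E20.
  move=> t s2 [F2 G2] le_t Ek2 E22 E22'.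
  have /= Ej2 := F2 j_ isT.
  split; last first.
    rewrite /upd /= Ej2 /upd /= Ej addn1; have -> : m - j = (m - j.+1).+1 by lia.
    by rewrite mulSn; lia.
  rewrite /= Ej2 /upd /= Ej; exists j.+1 => //; split; rewrite ?addn1 //.
    move=> j' jj'; have [->//|ne] := eqVneq j' j.+1.
    by rewrite E22' //=; apply: E2; lia.
  by move=> j' jj'; rewrite E22' //=; [apply: E20|]; lia.
- move=> t s1 FG [j jm [Ej Ek E2 E20]]; rewrite /= Ej FG.1 //= => nlt le_t.
  have Ej' : j = m by lia.
  apply: HQ => //; last by rewrite -Ej'.
    move: le_t; rewrite /= subn0 Ej' subnn mul0n addn0 => le_t.
    by apply: leq_trans le_t _; rewrite leq_add2l.
  by rewrite Ek Ej'.
Qed.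

Lemma floor_budget_spec Q s K :
  nmem s k_ 0 = K -> nmem s b_ 0 = 0 -> rmem s 3 0 = 0%R -> rmem s 1 0 = B ->
  (0 <= B)%R ->
  (forall t s' b, frame floor_budget s s' -> t <= 60 * K.*2 + 60 ->
     nmem s' b_ 0 = b -> b <= K.*2 -> (b%:R <= B)%R ->
     b = K.*2 \/ (B < b.+1%:R)%R -> Q t s') ->
  wp floor_budget Q s.
Proof.
move=> Ek Eb E3 EB B0 HQ.
apply: (wp_while (I := fun s1 => exists b,
   [/\ nmem s1 b_ 0 = b, b <= K.*2, rmem s1 3 0 = b%:R%R & (b%:R <= B)%R])
  (pot := fun s1 => 60 * (K.*2 - nmem s1 b_ 0))).
- by exists 0; split=> //; rewrite Eb.
- move=> s1 [F G] [b [Eb1 bK E31 bB]]; have Ek1 := F k_ isT; have EB1 := G 1 isT.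
  rewrite /= Eb1 Ek1 Ek EB1 EB E31.
  rewrite addn1 addnn => /andP[lt le]; split; last by rewrite /upd /=; lia.
  by exists b.+1; rewrite /upd /= ?Eb1 ?addn1 -?natr1.
- move=> t s1 FG [b [Eb1 bK E31 bB]]; have [F G] := FG.
  have Ek1 := F k_ isT; have EB1 := G 1 isT.
  rewrite /= Eb1 Ek1 Ek EB1 EB E31 addn1 addnn natr1 negb_and -ltNge => H le_t.
  apply: (HQ _ _ _ _ _ Eb1 bK bB) => //; first by move: le_t; rewrite Eb; lia.
  by case/orP: H => [H|->]; [left; lia|right].
Qed.

Lemma cost_table_spec Q s :
  nmem s 0 0 = m -> nmem s 0 1 = n -> nmem s 8 0 = 0 ->
  (forall t s', frame cost_table s s' -> t <= 60 * m + 60 ->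
     (forall k, k <= m -> nmem s' 8 k = (uphalf k).*2 * n.+1) -> Q t s') ->
  wp cost_table Q s.
Proof.
move=> Em En E8 HQ; apply: wp_frame; rewrite /cost_table /=.
apply: (wp_while (I := fun s1 => exists j,
   [/\ nmem s1 j_ 0 = j, j <= m &
     forall k, k <= j.+1 -> nmem s1 8 k = (uphalf k).*2 * n.+1])
  (pot := fun s1 => 60 * (m - nmem s1 j_ 0))).
- exists 0; split=> // k; rewrite /upd /= En => k1.
  (* Entry 0 is the initial zero of the memory; entry 1 is stored before the loop. *)
  have [->|->] : k = 0 \/ k = 1 by lia.
    by rewrite /= E8.
  by rewrite /=; lia.
- move=> s1 [F G] [j [Ej jm H8]]; rewrite /= Ej F //= /upd /= Em En => ltj.
  split; last by rewrite /= Ej; lia.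
  exists j.+1; split; rewrite /= ?Ej ?addn1 //; first by lia.
  move=> k kj; rewrite H8 //; case: eqVneq => [->|ne]; last by apply: H8; lia.
  by rewrite !addn2 /= doubleS !mulSn; lia.
- move=> t s1 FG [j [Ej jm H8]]; rewrite /= Ej FG.1 // /upd /= Em => nlt le_t F.
  by apply: HQ => // [|k km]; [lia|apply: H8; lia].
Qed.

Lemma half_table_spec Q s : 0 < m -> nmem s 0 0 = m ->
  (forall t s', frame half_table s s' -> t <= 60 * m + 60 ->
     (forall u, 2 <= u < m.*2 -> nmem s' 9 u = u./2) -> Q t s') ->
  wp half_table Q s.
Proof.
move=> m0 Em HQ; apply: wp_frame; rewrite /half_table /=.
apply: (wp_while (I := fun s1 => exists j,
   [/\ nmem s1 j_ 0 = j, 1 <= j <= m &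
     forall u, 2 <= u < j.*2 -> nmem s1 9 u = u./2])
  (pot := fun s1 => 60 * (m - nmem s1 j_ 0))).
- by exists 1; split=> //; lia.
- move=> s1 [F G] [j [Ej jm H9]]; rewrite /= Ej F //= /upd /= Em => ltj.
  split; last by rewrite /= Ej; lia.
  exists j.+1; split; rewrite /= ?Ej ?addn1 //; first by lia.
  move=> u uj; case: eqVneq => [->|ne]; first by lia.
  case: eqVneq => [->|ne2]; first by lia.
  by apply: H9; lia.
- move=> t s1 FG [j [Ej jm H9]]; rewrite /= Ej FG.1 // /upd /= Em => nlt le_t F.
  by apply: HQ => // [|u um]; [lia|apply: H9; lia].
Qed.

End TableSpec.

(** * Selecting the rows *)

(** The disjunction in [beats], written with negation and conjunction by De Morgan. *)
Definition beats_test (x y : nexp) : bexp :=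
  BNot (BAnd (BLeN (cst 1) y)
             (BNot (BAnd (BLeN (cst 1) x) (BLeR (RLoad 2 x) (RLoad 2 y))))).

(** Replays the matches on the path from the changed leaf [u_] to the root. *)
Definition climb : prog :=
  While (BLeN (cst 2) (var u_))
    (set u_ (NLoad 9 (var u_));;
     If (beats_test (NLoad 11 (var u_ +n var u_))
                    (NLoad 11 (var u_ +n var u_ +n cst 1)))
       (NStore 11 (var u_) (NLoad 11 (var u_ +n var u_)))
       (NStore 11 (var u_) (NLoad 11 (var u_ +n var u_ +n cst 1)))).

Definition insert_row : prog :=
  set i_ (var i_ +n cst 1);;
  RStore 4 (cst 0) (RAdd (RLoad 4 (cst 0)) (RLoad 2 (var i_)));;
  set sz_ (var sz_ +n cst 1);;
  set u_ (NSub (m_ +n var i_) (cst 1));;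
  NStore 11 (var u_) (var i_);;
  climb.

Definition discard_row : prog :=
  set k_ (NLoad 11 (cst 1));;
  NStore 10 (var k_) (var i_);;
  RStore 4 (cst 0) (RSub (RLoad 4 (cst 0)) (RLoad 2 (var k_)));;
  set sz_ (NSub (var sz_) (cst 1));;
  set u_ (NSub (m_ +n var k_) (cst 1));;
  NStore 11 (var u_) (cst 0);;
  climb.

Definition discard_rows : prog :=
  While (BNot (BLeN (NLoad 8 (var sz_) +n (var i_ +n var i_)) (var b_ +n cst 2)))
    discard_row.

(** The comparison is not strict, so that the first stage is recorded even when its reward is 0. *)
Definition record_best : prog :=
  If (BLeR (RLoad 5 (cst 0)) (RLoad 4 (cst 0)))
    (RStore 5 (cst 0) (RLoad 4 (cst 0));; set bi_ (var i_))
    Skip.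

(** The second test is made before [i_] is incremented: going down to row [i + 1] and back costs
    [2 i] even if no row is crossed. *)
Definition choose_rows : prog :=
  While (BAnd (BLeN (var i_ +n cst 1) m_) (BLeN (var i_ +n var i_) (var b_)))
    (insert_row;; discard_rows;; record_best).

(** * Correctness and amortised running time of the selection *)

Section SelectionSpec.

Variables (R : realType) (m n b : nat).
Implicit Types (s : state R) (Q : nat -> state R -> Prop).

Lemma beatsE (f : nat -> R) x y :
  ~~ ((0 < y) && ~~ ((0 < x) && (f x <= f y)%R)) = beats f x y.
Proof. by rewrite /beats negb_and negbK -leqNgt leqn0 lt0n. Qed.

Definition climb_time := 100 * (trunc_log 2 m.*2).+1.

(** The only match that may be wrong is the one at the parent of the current node. Halving the node
    lowers its binary logarithm by one, which bounds the time. *)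
Lemma climb_spec Q s u :
  1 <= u < m.*2 -> nmem s u_ 0 = u ->
  (forall v, 2 <= v < m.*2 -> nmem s 9 v = v./2) ->
  (forall v, 1 <= v < m -> v != u./2 -> match_won (rmem s 2) (nmem s 11) v) ->
  (forall t s', frame climb s s' -> t <= climb_time ->
     (forall v, 1 <= v < m -> match_won (rmem s' 2) (nmem s' 11) v) ->
     (forall v, m <= v -> nmem s' 11 v = nmem s 11 v) -> Q t s') ->
  wp climb Q s.
Proof.
move=> um Eu half_ok won HQ.
apply: (wp_while (I := fun s1 => exists u1, [/\ nmem s1 u_ 0 = u1, 1 <= u1 < m.*2,
   (forall v, 1 <= v < m -> v != u1./2 -> match_won (rmem s1 2) (nmem s1 11) v) &
   forall v, m <= v -> nmem s1 11 v = nmem s 11 v])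
  (pot := fun s1 => 100 * trunc_log 2 (nmem s1 u_ 0))).
- by exists u.
- move=> s1 [F G] [u1 [Eu1 u1m won1 leaf1]] lt.
  have H9 := F 9 isT.
  have /= u2 : 1 < u1 by move: lt; rewrite /= Eu1.
  rewrite /= beatsE /upd /= Eu1 H9 half_ok; last by lia.
  set p := u1./2; have pm : 1 <= p < m by rewrite /p; lia.
  rewrite addn1 addnn.
  have EL : trunc_log 2 u1 = (trunc_log 2 p).+1 by rewrite /p -trunc_log2S.
  pose x := if beats (rmem s1 2) (nmem s1 11 p.*2) (nmem s1 11 p.*2.+1)
            then nmem s1 11 p.*2 else nmem s1 11 p.*2.+1.
  have step y : y = x -> (forall v, 1 <= v < m -> v != p./2 ->
      match_won (rmem s1 2) (fun i' => if i' == p then y else nmem s1 11 i') v) /\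
      (forall v, m <= v -> (if v == p then y else nmem s1 11 v) = nmem s 11 v).
    move=> Ey; split=> [v vm nv|v vm]; last by rewrite ifN; [apply: leaf1|lia].
    rewrite /match_won /=; have [->|ne] := eqVneq v p.
      have -> : (p.*2 == p) = false by lia.
      by have -> : (p.*2.+1 == p) = false by lia.
    have -> : (v.*2 == p) = false by lia.
    have -> : (v.*2.+1 == p) = false by lia.
    exact: won1.
  case: ifP => Hb /=; (split; last by rewrite EL mulnS; lia); exists p.
  + have [|won' leaf'] := step (nmem s1 11 p.*2); first by rewrite /x Hb.
    by split=> //; lia.
  + have [|won' leaf'] := step (nmem s1 11 p.*2.+1); first by rewrite /x Hb.
    by split=> //; lia.
- move=> t s1 FG [u1 [Eu1 u1m won1 leaf1]]; rewrite /= Eu1 => nlt le_t.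
  apply: HQ => //.
    rewrite /climb_time; have : trunc_log 2 u <= trunc_log 2 m.*2.
      by apply: leq_trunc_log; lia.
    by move: le_t; rewrite Eu; lia.
  (* At the root the excepted index is [1./2 = 0], which is no match. *)
  by move=> v vm; apply: won1 => //; lia.
Qed.

Definition tables s : Prop :=
  [/\ nmem s 0 0 = m, nmem s b_ 0 = b,
      (forall k, k <= m -> nmem s 8 k = (uphalf k).*2 * n.+1)
    & forall v, 2 <= v < m.*2 -> nmem s 9 v = v./2].

Lemma tables_frame P s s' :
  frame P s s' -> all (fun a => a \notin nwrites P) [:: 0; b_; 8; 9] ->
  tables s -> tables s'.
Proof.
by move=> [F _] /and5P[n0 n7 n8 n9 _]; rewrite /tables !F.
Qed.

Local Notation current s i := (active (nmem s 10) i).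

Definition selection s i : Prop :=
  [/\ nmem s i_ 0 = i, nmem s sz_ 0 = size (current s i),
      rmem s 4 0 = (\sum_(j <- current s i) rmem s 2 j)%R,
      greedy n b (rmem s 2) i (current s i)
    & [/\ forall j, nmem s 10 j <= i, forall j, i < j -> nmem s 10 j = 0,
          forall v, 1 <= v < m -> match_won (rmem s 2) (nmem s 11) v
        & forall j, j \in iota 1 m ->
            nmem s 11 (m + j).-1 = if j \in current s i then j else 0]].

Lemma insert_row_spec Q s i : i < m -> tables s -> selection s i ->
  fits n b (size (current s i)) i ->
  (forall t s', frame insert_row s s' -> t <= climb_time + 60 ->
     selection s' i.+1 -> Q t s') ->
  wp insert_row Q s.
Proof.
move=> im [Em _ _ half_ok] [Ei Esz Ecur gr [di d0 won leaf]] fit HQ.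
apply: wp_frame; rewrite /insert_row /=.
have Eu : m + (i + 1) - 1 = m + i by lia.
apply: (@climb_spec _ _ (m + i)); rewrite /upd /= ?Ei ?Em ?Eu //.
- by lia.
(* Row [i + 1] sits at leaf [m + i]; a match reads this leaf only at its parent, which is the
   exception allowed. *)
- move=> v vm nv; rewrite /match_won.
  have -> : (v == m + i) = false by lia.
  have -> : (v.*2 == m + i) = false by lia.
  have -> : (v.*2.+1 == m + i) = false by lia.
  exact: won.
move=> t s' [F G] le_t won' leaf' FG; have [F' G'] := FG.
have E10 := F' 10 isT; have E2 := G' 2 isT.
have d0' : nmem s 10 i.+1 = 0 by apply: d0.
apply: HQ => //; first by lia.
rewrite /selection E10 E2 active_insert //; split.
- by rewrite (F 13 isT) /= /upd /= addn1.
- by rewrite (F 14 isT) /= /upd /= Esz size_rcons addn1.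
- by rewrite (G 4 isT) /= /upd /= addn1 big_rcons /= Ecur addrC.
- by apply: greedy_insert => //; [apply: active_sub|apply: active_uniq].
split.
- by move=> j; apply: leq_trans (di j) _.
- by move=> j ij; apply: d0; lia.
- by move=> v vm; rewrite -E2; apply: won'.
- move=> j jm; rewrite mem_rcons inE leaf' /=; last by move: jm; rewrite mem_iota; lia.
  rewrite mem_iota in jm; case: (eqVneq j i.+1) => [->|ne].
    by rewrite addnS /= eqxx addn1.
  have -> : ((m + j).-1 == m + i) = false by lia.
  by apply: leaf; rewrite mem_iota.
Qed.

Lemma discard_row_spec Q s i : 1 <= i <= m -> i.*2 <= b.+2 ->
  tables s -> selection s i -> ~~ fits n b (size (current s i)) i ->
  (forall t s', frame discard_row s s' -> t <= climb_time + 60 ->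
     selection s' i -> (size (current s' i)).+1 = size (current s i) ->
     (forall i', i' < i -> active_at (nmem s' 10) i' = active_at (nmem s 10) i') ->
     Q t s') ->
  wp discard_row Q s.
Proof.
move=> im ib [Em _ _ half_ok] [Ei Esz Ecur gr [di d0 won leaf]] nf HQ.
set A := current s i in Esz Ecur gr leaf nf HQ.
(* The empty set fits because [i.*2 <= b.+2], so there is a row to discard. *)
have A0 : 0 < size A.
  by rewrite lt0n; apply: contra nf => /eqP->; rewrite /fits /= mul0n.
have sA : {subset A <= iota 1 m}.
  by move=> j /active_sub; rewrite !mem_iota; lia.
have m0 : 0 < m by lia.
have lst := root_least won m0 sA A0 leaf.
set x := nmem s 11 1 in lst *; have [xA minx] := lst.
have xi : 1 <= x <= i by have := active_sub xA; rewrite mem_iota; lia.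
have dx : nmem s 10 x = 0 by move: xA; rewrite mem_filter => /andP[/eqP].
apply: wp_frame; rewrite /discard_row /=.
have Eu : m + x - 1 = (m + x).-1 by lia.
apply: (@climb_spec _ _ (m + x).-1); rewrite /upd /= ?Ei ?Em ?Eu //.
- by lia.
- move=> v vm nv; rewrite /match_won.
  have -> : (v == (m + x).-1) = false by lia.
  have -> : (v.*2 == (m + x).-1) = false by lia.
  have -> : (v.*2.+1 == (m + x).-1) = false by lia.
  exact: won.
move=> t s' [F G] le_t won' leaf' FG; have [F' G'] := FG.
have E2 := G' 2 isT.
have E10 j : nmem s' 10 j = if j == x then i else nmem s 10 j.
  by rewrite (F 10 isT).
have EA : current s' i = rem x A.
  apply: active_rem; first by rewrite E10 eqxx; lia.
  by move=> j nj; rewrite E10 (negPf nj).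
apply: HQ => //; first by lia.
- rewrite /selection EA E2; split.
  + by rewrite (F 13 isT) /= /upd /= Ei.
  + by rewrite (F 14 isT) /= /upd /= Esz size_rem // subn1.
  + rewrite (G 4 isT) /= /upd /= Ecur (perm_big _ (perm_to_rem xA)) big_cons /=.
    by rewrite addrAC subrr add0r.
  + by apply: greedy_rem => //; apply: active_uniq.
  split.
  + by move=> j; rewrite E10; case: eqP => // _; apply: di.
  + by move=> j ij; rewrite E10 ifN; [apply: d0|lia].
  + by move=> v vm; rewrite -E2; apply: won'.
  + move=> j jm; rewrite mem_rem_uniq ?active_uniq // inE leaf' /=; last first.
      by move: jm; rewrite mem_iota; lia.
    rewrite mem_iota in jm; case: (eqVneq j x) => [->|ne]; first by rewrite eqxx.
    have -> : ((m + j).-1 == (m + x).-1) = false by lia.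
    by apply: leaf; rewrite mem_iota.
- by rewrite EA size_rem // prednK.
(* Row [x] had not been discarded and now leaves at stage [i], so it still counts at every earlier
   stage. *)
- move=> i' lt; apply: eq_filter => j; rewrite E10.
  by case: eqP => // ->; rewrite dx; lia.
Qed.

Definition discard_time := climb_time + 200.

Lemma size_active_leq d i : size (active d i) <= i.
Proof. by rewrite size_filter (leq_trans (count_size _ _)) // size_iota. Qed.

(** Each removal is paid for by the drop in the number of current rows; the time bound carries the
    unspent credit along. *)
Lemma discard_rows_spec Q s i : 1 <= i <= m -> i.*2 <= b.+2 ->
  tables s -> selection s i ->
  (forall t s', frame discard_rows s s' -> selection s' i ->
     fits n b (size (current s' i)) i ->
     t + discard_time * size (current s' i) <=
       discard_time * size (current s i) + 60 ->
     (forall i', i' < i -> active_at (nmem s' 10) i' = active_at (nmem s 10) i') ->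
     Q t s') ->
  wp discard_rows Q s.
Proof.
move=> im ib tab sel HQ.
have test s1 : frame discard_row s s1 -> selection s1 i ->
    (nmem s1 8 (nmem s1 sz_ 0) + (nmem s1 i_ 0 + nmem s1 i_ 0) <= nmem s1 b_ 0 + 2)
    = fits n b (size (current s1 i)) i.
  move=> F; have [_ Eb E8 _] := tables_frame F isT tab; move=> [Ei Esz _ _ _].
  rewrite Ei Esz Eb E8 ?addnn ?addn2 //.
  by apply: leq_trans (size_active_leq _ _) _; lia.
apply: (wp_while (I := fun s1 => selection s1 i /\
   forall i', i' < i -> active_at (nmem s1 10) i' = active_at (nmem s 10) i')
  (pot := fun s1 => discard_time * size (current s1 i))).
- by [].
- move=> s1 F [sel1 at1] nfit.
  have {}nfit : ~~ fits n b (size (current s1 i)) i by rewrite -test.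
  apply: discard_row_spec sel1 nfit _ => //; first exact: tables_frame F isT tab.
  move=> t s2 F2 le_t sel2 Esz at2; split.
    by split=> // i' lt; rewrite at2 // at1.
  by rewrite -Esz mulnS /discard_time /=; lia.
- move=> t s1 F [sel1 at1] fit1 le_t.
  have {}fit1 : fits n b (size (current s1 i)) i.
    by rewrite -test //; rewrite /= negbK in fit1.
  by apply: HQ => //; apply: leq_trans le_t _; rewrite leq_add2l.
Qed.

(** The best set is never copied: its stage [bi] suffices, since later discards do not alter
    [active_at] at [bi]. *)
Definition best_so_far s i : Prop :=
  let bi := nmem s bi_ 0 in let A := active_at (nmem s 10) bi in
  [/\ 1 <= bi <= i, rmem s 5 0 = (\sum_(j <- A) rmem s 2 j)%R,
      fits n b (size A) bi
    & forall i' S, 1 <= i' <= i -> {subset S <= iota 1 i'} -> uniq S ->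
        fits n b (size S) i' -> (\sum_(j <- S) rmem s 2 j <= rmem s 5 0)%R].

Lemma choose_rows_spec Q s : 0 < m -> tables s ->
  (forall j, 1 <= j <= m -> (0 <= rmem s 2 j)%R) ->
  nmem s i_ 0 = 0 -> nmem s sz_ 0 = 0 ->
  (forall k, nmem s 10 k = 0) -> (forall k, nmem s 11 k = 0) ->
  rmem s 4 0 = 0%R -> rmem s 5 0 = 0%R ->
  (forall t s' i, frame choose_rows s s' -> t <= discard_time * m.*2 + 60 ->
     1 <= i <= m -> i = m \/ b < i.*2 -> best_so_far s' i -> Q t s') ->
  wp choose_rows Q s.
Proof.
move=> m0 tab f0 Ei Esz E10 E11 E4 E5 HQ.
(* Every stage to come holds two credits, one spent on inserting its row and one kept with the row
   for its possible removal. *)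
apply: (wp_while (I := fun s1 => exists i, [/\ i <= m, selection s1 i,
    fits n b (size (current s1 i)) i &
    (i = 0 /\ rmem s1 5 0 = 0%R) \/ best_so_far s1 i])
  (pot := fun s1 => discard_time * (m - nmem s1 i_ 0).*2 +
                    discard_time * nmem s1 sz_ 0)).
- exists 0; split=> //; last by left.
  rewrite /selection; split=> //; first by rewrite E4 big_nil.
    exact: Or31.
  split=> // [j|v vm]; first by rewrite E10.
  by rewrite /match_won !E11.
- move=> s1 F [i [im sel1 fit1 best1]]; have tab1 := tables_frame F isT tab.
  have [Em Eb _ _] := tab1; have [Ei1 Esz1 _ _ [di1 d01 _ _]] := sel1.
  rewrite [beval _ _]/= Em Ei1 Eb => /andP[lt le2].
  have {}im : i < m by lia.
  apply: wp_seq; apply: insert_row_spec sel1 fit1 _ => // t1 s2 F2 le1 sel2.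
  have tab2 := tables_frame F2 isT tab1.
  have sz2 : size (current s2 i.+1) = (size (current s1 i)).+1.
    by rewrite (F2.1 10 isT) active_insert ?size_rcons // d01.
  apply: wp_seq; apply: discard_rows_spec sel2 _ => //; first by lia.
  move=> t2 s3 F3 sel3 fit3 le_t2 at3.
  have [Ei3 Esz3 Ecur3 gr3 [di3 _ _ _]] := sel3.
  have E2 : rmem s3 2 = rmem s 2.
    by rewrite (F3.2 2 isT) (F2.2 2 isT) (F.2 2 isT).
  have E5' : rmem s3 5 = rmem s1 5 by rewrite (F3.2 5 isT) (F2.2 5 isT).
  have Ebi : nmem s3 bi_ = nmem s1 bi_ by rewrite (F3.1 bi_ isT) (F2.1 bi_ isT).
  have at13 i' : i' < i.+1 -> active_at (nmem s3 10) i' = active_at (nmem s1 10) i'.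
    by move=> /at3->; rewrite (F2.1 10 isT).
  have f0' j : j \in iota 1 i.+1 -> (0 <= rmem s3 2 j)%R.
    by rewrite E2 mem_iota => ji; apply: f0; lia.
  have opt3 S : {subset S <= iota 1 i.+1} -> uniq S -> fits n b (size S) i.+1 ->
      (\sum_(j <- S) rmem s3 2 j <= rmem s3 4 0)%R.
    move=> sS uS fS; rewrite Ecur3; apply: greedy_optimal gr3 _ _ _ _ => //.
      exact: active_sub.
    exact: active_uniq.
  have old : (0 <= rmem s3 5 0)%R /\ forall i' S, 1 <= i' <= i ->
      {subset S <= iota 1 i'} -> uniq S -> fits n b (size S) i' ->
      (\sum_(j <- S) rmem s3 2 j <= rmem s3 5 0)%R.
    rewrite E5' E2 -(F.2 2 isT); case: best1 => [[i0 ->]|[bi1 _ _ opt1]].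
      by split=> // i' S; rewrite i0; lia.
    split=> //; have := opt1 1 [::]; rewrite big_nil; apply=> //; lia.
  have timing : forall t3, t3 <= 30 -> bcost (BAnd (BLeN (var i_ +n cst 1) m_)
      (BLeN (var i_ +n var i_) (var b_))) + (t1 + (t2 + t3)) +
      (discard_time * (m - i.+1).*2 + discard_time * size (current s3 i.+1)) <=
      discard_time * (m - i).*2 + discard_time * size (current s1 i).
    move=> t3 le_t3; move: le_t2; rewrite sz2 mulnS.
    have -> : (m - i).*2 = (m - i.+1).*2.+2 by lia.
    rewrite !mulnS; move: (discard_time * (m - i.+1).*2) => p.
    move: (discard_time * size (current s1 i)) => q.
    move: (discard_time * size (current s3 i.+1)) => q'.
    by rewrite /discard_time /=; lia.
  rewrite /record_best /=; case: ifPn => le54 /=.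
  + split; last first.
      by rewrite /upd /= ?Ei1 Ei3 Esz3 Esz1; apply: timing.
    exists i.+1; split=> //; right.
    rewrite /best_so_far /upd /= Ei3 active_atE //; split=> //; first by lia.
    move=> i' S i'i sS uS fS; have [Ei'|ne] := eqVneq i' i.+1.
      by rewrite Ei' in sS fS; apply: opt3.
    by apply: le_trans le54; apply: old.2 sS uS fS; lia.
  + rewrite -ltNge in le54; split.
      exists i.+1; split=> //; right; rewrite /best_so_far.
      (* Hence a refusal cannot happen at the first stage, where the best reward is still 0. *)
      have pos4 : (0 <= rmem s3 4 0)%R.
        have := opt3 [::]; rewrite big_nil; apply=> //.
        exact: fits_leq fit3.
      case: best1 => [[_ E50]|[bi1 E51 fit51 opt1]].
        by move: (le_lt_trans pos4 le54); rewrite E5' E50 ltxx.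
      rewrite Ebi at13; last by lia.
      split=> //; first by lia.
        by rewrite E5' E51 E2 (F.2 2 isT).
      move=> i' S i'i sS uS fS; have [Ei'|ne] := eqVneq i' i.+1.
        by rewrite Ei' in sS fS; apply: le_trans (ltW le54); apply: opt3.
      by apply: old.2 sS uS fS; lia.
    by rewrite /upd /= ?Ei1 Ei3 Esz3 Esz1; apply: timing.
- move=> t s1 F [i [im sel1 fit1 best1]]; have [Em Eb _ _] := tables_frame F isT tab.
  have [Ei1 _ _ _ _] := sel1; rewrite /= Em Eb Ei1 Ei Esz => nlt le_t.
  have i0 : 0 < i by lia.
  case: best1 => [[i00]|best1]; first by rewrite i00 in i0.
  apply: (HQ _ _ _ F _ _ _ best1); last by lia.
    apply: leq_trans (leq_trans (leq_addr _ _) le_t) _.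
    by rewrite subn0 muln0 addn0 leq_add2l.
  by lia.
Qed.

End SelectionSpec.

(** * Writing the walk *)

Definition emit : prog :=
  NStore 2 (var 1) (var j_);; NStore 3 (var 1) (var c_);; set 1 (var 1 +n cst 1).

Definition cross : prog :=
  If (BLeN (var c_) (cst 0))
    (While (BLeN (var c_ +n cst 1) (n_ +n cst 1)) (set c_ (var c_ +n cst 1);; emit))
    (While (BLeN (cst 1) (var c_)) (set c_ (NSub (var c_) (cst 1));; emit)).

Definition cross_if_active : prog :=
  If (BAnd (BLeN (cst 1) (NLoad 10 (var j_))) (BLeN (NLoad 10 (var j_)) (var bi_)))
    Skip cross.

Definition walk_down : prog :=
  While (BLeN (var j_ +n cst 1) (var bi_))
    (cross_if_active;; set j_ (var j_ +n cst 1);; emit).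

Definition walk_up : prog :=
  While (BLeN (cst 2) (var j_)) (set j_ (NSub (var j_) (cst 1));; emit).

(** After the last row, the right side is reached exactly when the number of crossings is odd; one
    more crossing then leads back to column 0. *)
Definition write_walk : prog :=
  set j_ (cst 1);; set c_ (cst 0);; emit;; walk_down;; cross_if_active;;
  If (BLeN (cst 1) (var c_)) cross Skip;; walk_up.

(** * Correctness and length of the walk written *)

Section WalkSpec.

Variables (R : realType) (m n : nat).
Implicit Types (s : state R) (Q : nat -> state R -> Prop) (w : seq vertex).

Definition walk_to w v : Prop := exists q,
  [/\ w = (1, 0) :: q, path (aisle_edge m n) (1, 0) q, last (1, 0) q = v
    & full_row n w].

Lemma walk_to_mem w v : walk_to w v -> v \in w.
Proof. by move=> [q [-> _ <- _]]; apply: mem_last. Qed.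

Definition penultimate w : vertex := nth (0, 0) w (size w).-2.

(** Appending [v] creates one new place where the walk could reverse, namely [u], and this matters
    only if [u] is in an inner column. *)
Lemma walk_to_rcons w u v : walk_to w u -> aisle_edge m n u v ->
  (1 <= u.2 <= n -> penultimate w <> v) ->
  walk_to (rcons w v) v /\ penultimate (rcons w v) = u.
Proof.
move=> [q [Ew pq lq fw]] uv pen.
have lw : last (0, 0) w = u by rewrite Ew.
have w0 : 0 < size w by rewrite Ew.
split; last first.
  by rewrite /penultimate size_rcons /= nth_rcons prednK // leqnn nth_last.
exists (rcons q v); split.
- by rewrite Ew rcons_cons.
- by rewrite rcons_path pq lq.
- by rewrite last_rcons.
move=> k; rewrite size_rcons ltnS leq_eqVlt => /orP[/eqP Ek|ltk].
  rewrite !nth_rcons -Ek ltnn eqxx !ltnS leqnn leqnSn.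
  have -> : k = (size w).-2 by rewrite -Ek.
  have Ek1 : (size w).-2.+1 = (size w).-1 by rewrite -Ek.
  by rewrite Ek1 nth_last lw => /pen ne /esym.
by rewrite !nth_rcons ltk (ltn_trans _ ltk) // (ltn_trans _ ltk) //; apply: fw.
Qed.

Lemma emit_spec Q s :
  (forall t s', frame emit s s' -> t <= 20 ->
     output_walk s' = rcons (output_walk s) (nmem s j_ 0, nmem s c_ 0) -> Q t s') ->
  wp emit Q s.
Proof.
move=> HQ; apply: wp_frame; rewrite /emit /= => F; apply: HQ => //.
rewrite /output_walk /upd /= iotaD map_cat /= add0n !eqxx -cats1.
congr (_ ++ _); apply/eq_in_map => k; rewrite mem_iota add0n => /andP[_ lt].
by rewrite (ltn_eqF lt).
Qed.

Lemma cross_spec Q s j : 1 <= j <= m -> nmem s 0 1 = n -> nmem s j_ 0 = j ->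
  nmem s c_ 0 = 0 \/ nmem s c_ 0 = n.+1 ->
  walk_to (output_walk s) (j, nmem s c_ 0) ->
  (forall t s', frame cross s s' -> t <= 60 * n.+2 ->
     nmem s' c_ 0 = n.+1 - nmem s c_ 0 ->
     walk_to (output_walk s') (j, n.+1 - nmem s c_ 0) ->
     {subset output_walk s <= output_walk s'} ->
     (forall c, c <= n.+1 -> (j, c) \in output_walk s') ->
     size (output_walk s') = size (output_walk s) + n.+1 -> Q t s') ->
  wp cross Q s.
Proof.
move=> jm En Ej [] Ec; rewrite Ec => wt HQ; have jin := walk_to_mem wt; apply: wp_frame;
  rewrite /cross [wp _ _ _]/= Ec /=.
(* The previous vertex is tracked to exclude a reversal. The alternative [c = 0] covers the start,
   which lies in an end column. *)
- apply: (wp_while (I := fun s1 => let w := output_walk s1 in exists c,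
     [/\ nmem s1 c_ 0 = c, c <= n.+1, walk_to w (j, c),
         c = 0 \/ penultimate w = (j, c.-1)
       & [/\ {subset output_walk s <= w}, forall c', c' <= c -> (j, c') \in w
           & size w = size (output_walk s) + c]])
    (pot := fun s1 => 60 * (n.+1 - nmem s1 c_ 0))).
  + exists 0; split=> //; first by left.
    by split=> // [c'|]; rewrite ?addn0 // leqn0 => /eqP->.
  + move=> s1 [F G] [c [Ec1 cn wt1 pen1 [sub1 in1 sz1]]].
    have Ej1 := F j_ isT; have En1 := F 0 isT.
    rewrite [beval _ _]/= Ec1 En1 En => ltc.
    apply: wp_seq; apply: wp_nstore; apply: emit_spec => t s2 [F2 G2] le_t Ew.
    have Ec2 := F2 c_ isT.
    have Ew2 : output_walk s2 = rcons (output_walk s1) (j, c.+1).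
      by rewrite Ew /= /upd /= Ec1 Ej1 Ej addn1.
    have [||wt2 pen2] := @walk_to_rcons (output_walk s1) (j, c) (j, c.+1) wt1.
    * by rewrite /aisle_edge /aisle_arc /aisle_vertex /= !eqxx; lia.
    * by move=> c1; case: pen1 => [c0|->] /=; [rewrite c0 in c1|case; lia].
    split; last by rewrite Ec2 /upd /= Ec1; lia.
    rewrite /= Ew2.
    exists c.+1; split=> //; first by rewrite Ec2 /upd /= Ec1 addn1.
      by lia.
      by right.
    split.
    * by move=> v /sub1 vin; rewrite mem_rcons inE vin orbT.
    * move=> c'; rewrite leq_eqVlt mem_rcons inE => /orP[/eqP->|lt].
        by rewrite eqxx.
      by rewrite in1 ?orbT.
    * by rewrite size_rcons sz1 addnS.
  + move=> t s1 [F G] [c [Ec1 cn wt1 pen1 [sub1 in1 sz1]]].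
    have En1 := F 0 isT; rewrite /= Ec1 Ec En1 En => nlt le_t FG.
    have Ecn : c = n.+1 by lia.
    by rewrite Ecn in Ec1 wt1 in1 sz1; apply: HQ; rewrite ?subn0 //; lia.
- apply: (wp_while (I := fun s1 => let w := output_walk s1 in exists c,
     [/\ nmem s1 c_ 0 = c, c <= n.+1, walk_to w (j, c),
         c = n.+1 \/ penultimate w = (j, c.+1)
       & [/\ {subset output_walk s <= w},
           forall c', c <= c' <= n.+1 -> (j, c') \in w
           & size w + c = size (output_walk s) + n.+1]])
    (pot := fun s1 => 60 * nmem s1 c_ 0)).
  + exists n.+1; split=> //; first by left.
    by split=> // c' c'n; have -> : c' = n.+1 by lia.
  + move=> s1 [F G] [c [Ec1 cn wt1 pen1 [sub1 in1 sz1]]].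
    have Ej1 := F j_ isT; have En1 := F 0 isT.
    rewrite [beval _ _]/= Ec1 => ltc.
    apply: wp_seq; apply: wp_nstore; apply: emit_spec => t s2 [F2 G2] le_t Ew.
    have Ec2 := F2 c_ isT.
    have Ew2 : output_walk s2 = rcons (output_walk s1) (j, c.-1).
      by rewrite Ew /= /upd /= Ec1 Ej1 Ej subn1.
    have [||wt2 pen2] := @walk_to_rcons (output_walk s1) (j, c) (j, c.-1) wt1.
    * by rewrite /aisle_edge /aisle_arc /aisle_vertex /= !eqxx; lia.
    * by move=> /= c1; case: pen1 => [c0|->] /=; [lia|case; lia].
    split; last by rewrite Ec2 /upd /= Ec1; lia.
    rewrite /= Ew2.
    exists c.-1; split=> //; first by rewrite Ec2 /upd /= Ec1 subn1.
      by lia.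
      by right; rewrite prednK.
    split.
    * by move=> v /sub1 vin; rewrite mem_rcons inE vin orbT.
    * move=> c' c'n; rewrite mem_rcons inE; have [->|ne] := eqVneq c' c.-1.
        by rewrite eqxx.
      by rewrite in1 ?orbT //; lia.
    * by rewrite size_rcons; lia.
  + move=> t s1 [F G] [c [Ec1 cn wt1 pen1 [sub1 in1 sz1]]].
    rewrite /= Ec1 Ec => nlt le_t FG.
    have Ecn : c = 0 by lia.
    by rewrite Ecn ?addn0 in Ec1 wt1 in1 sz1; apply: HQ; rewrite ?subnn //; lia.
Qed.

(** The side is given by the parity of the crossings. The size counts the starting vertex, [j - 1]
    steps down and [n + 1] steps for each row of [S]. *)
Definition crossed s j (S : seq nat) : Prop :=
  [/\ nmem s j_ 0 = j, nmem s c_ 0 = (if odd (size S) then n.+1 else 0),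
      walk_to (output_walk s) (j, nmem s c_ 0),
      {subset row_vertices n S <= output_walk s}
    & size (output_walk s) = j + size S * n.+1].

Definition kept (d : nat -> nat) (bi j : nat) : bool := ~~ (1 <= d j <= bi).

Lemma cross_if_active_spec Q s bi j S :
  1 <= j <= m -> nmem s 0 1 = n -> nmem s bi_ 0 = bi -> crossed s j S ->
  (forall t s', frame cross_if_active s s' -> t <= 60 * n.+2 + 60 ->
     crossed s' j (if kept (nmem s 10) bi j then rcons S j else S) -> Q t s') ->
  wp cross_if_active Q s.
Proof.
move=> jm En Ebi cr HQ; have [Ej Ec wt sub sz] := cr.
apply: wp_frame; apply: wp_if; rewrite [beval _ _]/= Ej Ebi => H.
  by move=> F; apply: HQ => //; [rewrite /=; lia|rewrite /kept H].
apply: (@cross_spec _ _ j) => //; first by rewrite Ec; case: ifP; [right|left].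
move=> t s' [F G] le_t Ec' wt' sub' in' sz' FG.
apply: HQ => //; first by rewrite /=; lia.
rewrite /kept H; split.
- by rewrite (F j_ isT).
- by rewrite Ec' Ec size_rcons /=; case: (odd _) => /=; lia.
- by rewrite Ec'.
- move=> [a c]; rewrite mem_row_vertices mem_rcons inE => /andP[/orP[/eqP->|aS] cn].
    exact: in'.
  by apply: sub'; apply: sub; rewrite mem_row_vertices aS.
- by rewrite sz' sz size_rcons mulSn; lia.
Qed.

Lemma walk_down_spec Q s bi : 1 <= bi <= m -> nmem s 0 1 = n ->
  nmem s bi_ 0 = bi -> crossed s 1 [::] ->
  (forall t s', frame walk_down s s' -> t <= (60 * n.+2 + 200) * bi ->
     crossed s' bi [seq j <- iota 1 bi.-1 | kept (nmem s 10) bi j] -> Q t s') ->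
  wp walk_down Q s.
Proof.
move=> bim En Ebi cr HQ.
apply: (wp_while (I := fun s1 => exists2 j, 1 <= j <= bi &
   crossed s1 j [seq j' <- iota 1 j.-1 | kept (nmem s 10) bi j'])
  (pot := fun s1 => (60 * n.+2 + 200) * (bi - nmem s1 j_ 0))).
- by exists 1 => //; lia.
- move=> s1 [F G] [j jbi cr1]; have [Ej1 _ _ _ _] := cr1.
  have En1 := F 0 isT; have Ebi1 := F bi_ isT; have E10 := F 10 isT.
  rewrite [beval _ _]/= Ej1 Ebi1 Ebi => ltj.
  apply: wp_seq; apply: (@cross_if_active_spec _ _ bi j) cr1 _.
  + by lia.
  + by rewrite En1.
  + by rewrite Ebi1.
  rewrite E10 => t s2 [F2 G2] le_t; rewrite -filter_rcons rcons_iota1; last by lia.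
  move=> [Ej2 Ec2 wt2 sub2 sz2].
  apply: wp_seq; apply: wp_nstore; apply: emit_spec => t3 s3 [F3 G3] le_t3 Ew.
  have Ej3 : nmem s3 j_ 0 = j.+1 by rewrite (F3 j_ isT) /= /upd /= Ej2 addn1.
  have Ec3 : nmem s3 c_ 0 = nmem s2 c_ 0 by rewrite (F3 c_ isT).
  have Ew3 : output_walk s3 = rcons (output_walk s2) (j.+1, nmem s2 c_ 0).
    by rewrite Ew /= /upd /= Ej2 addn1.
  split; last first.
    rewrite Ej3 ?Ej1; have -> : bi - j = (bi - j.+1).+1 by lia.
    by rewrite mulnS /=; lia.
  exists j.+1; first by lia.
  have [||wt3 _] := @walk_to_rcons (output_walk s2) _ (j.+1, nmem s2 c_ 0) wt2.
  + rewrite /aisle_edge /aisle_arc /aisle_vertex /= !eqxx Ec2.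
    by case: ifP => _; lia.
  + by rewrite /= Ec2; case: ifP => _; lia.
  split; rewrite ?Ew3 ?Ec3 //.
  + by move=> v /sub2 vin; rewrite mem_rcons inE vin orbT.
  + by rewrite size_rcons sz2.
- move=> t s1 [F G] [j jbi cr1]; have [Ej1 _ _ _ _] := cr1.
  have Ebi1 := F bi_ isT; rewrite /= Ej1 Ebi1 Ebi => nlt le_t.
  have Ejbi : j = bi by lia.
  rewrite Ejbi in cr1; apply: HQ => //.
  have [Ej _ _ _ _] := cr; move: le_t; rewrite Ejbi subnn muln0 addn0 Ej => le_t.
  apply: leq_trans le_t _; rewrite -{2}(@subnK 1 bi) ?mulnDr; last by lia.
  by rewrite leq_add2l; lia.
Qed.

Lemma walk_up_spec Q s bi : 1 <= bi <= m -> nmem s j_ 0 = bi -> nmem s c_ 0 = 0 ->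
  walk_to (output_walk s) (bi, 0) ->
  (forall t s', t <= 60 * bi -> walk_to (output_walk s') (1, 0) ->
     {subset output_walk s <= output_walk s'} ->
     size (output_walk s') = size (output_walk s) + bi.-1 -> Q t s') ->
  wp walk_up Q s.
Proof.
move=> bim Ej Ec wt HQ.
apply: (wp_while (I := fun s1 => exists j,
   [/\ 1 <= j <= bi, nmem s1 j_ 0 = j, walk_to (output_walk s1) (j, 0),
       {subset output_walk s <= output_walk s1}
     & size (output_walk s1) + j = size (output_walk s) + bi])
  (pot := fun s1 => 60 * (nmem s1 j_ 0).-1)).
- by exists bi; split=> //; lia.
- move=> s1 [F G] [j [jbi Ej1 wt1 sub1 sz1]]; have Ec1 := F c_ isT.
  rewrite [beval _ _]/= Ej1 => ltj.
  apply: wp_seq; apply: wp_nstore; apply: emit_spec => t3 s3 [F3 G3] le_t3 Ew.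
  have Ej3 : nmem s3 j_ 0 = j.-1 by rewrite (F3 j_ isT) /= /upd /= Ej1 subn1.
  have Ew3 : output_walk s3 = rcons (output_walk s1) (j.-1, 0).
    by rewrite Ew /= /upd /= Ej1 Ec1 Ec subn1.
  split; last by rewrite Ej3 ?Ej1 /=; lia.
  have [||wt3 _] := @walk_to_rcons (output_walk s1) _ (j.-1, 0) wt1.
  + by rewrite /aisle_edge /aisle_arc /aisle_vertex /=; lia.
  + by [].
  exists j.-1; rewrite Ew3; split=> //; first by lia.
    by move=> v /sub1 vin; rewrite mem_rcons inE vin orbT.
  by rewrite size_rcons; lia.
- move=> t s1 [F G] [j [jbi Ej1 wt1 sub1 sz1]]; rewrite /= Ej1 Ej => nlt le_t.
  have j1 : j = 1 by lia.
  by rewrite j1 in wt1 sz1; apply: HQ => //; lia.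
Qed.

Lemma write_walk_spec Q s bi : 1 <= bi <= m -> nmem s 0 1 = n ->
  nmem s bi_ 0 = bi -> nmem s 1 0 = 0 ->
  let A := active_at (nmem s 10) bi in
  (forall t s', t <= (60 * n.+2 + 400) * m.+2 ->
     closed_walk m n (1, 0) (output_walk s') -> full_row n (output_walk s') ->
     walk_cost (output_walk s') = (uphalf (size A)).*2 * n.+1 + (bi.-1).*2 ->
     {subset row_vertices n A <= output_walk s'} -> Q t s') ->
  wp write_walk Q s.
Proof.
move=> bim En Ebi E1 A HQ.
apply: wp_seq; apply: wp_nstore; apply: wp_seq; apply: wp_nstore.
apply: wp_seq; apply: emit_spec => t1 s1 [F1 G1] le_t1 Ew1.
have {}Ew1 : output_walk s1 = [:: (1, 0)] by rewrite Ew1 /output_walk /= /upd /= E1.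
have cr1 : crossed s1 1 [::].
  split; rewrite ?Ew1 ?(F1 j_ isT) ?(F1 c_ isT) //.
  by exists [::]; split=> // k; rewrite ltnS.
apply: wp_seq; apply: walk_down_spec cr1 _; first exact: bim.
- by rewrite (F1 0 isT).
- by rewrite (F1 bi_ isT).
move=> t2 s2 [F2 G2] le_t2; rewrite (F1 10 isT) => cr2.
apply: wp_seq; apply: (@cross_if_active_spec _ _ bi bi) cr2 _; first by lia.
- by rewrite (F2 0 isT) (F1 0 isT).
- by rewrite (F2 bi_ isT) (F1 bi_ isT).
move=> t3 s3 [F3 G3] le_t3; rewrite (F2 10 isT) (F1 10 isT).
rewrite -filter_rcons rcons_iota1 -/A; last by lia.
move=> cr3; have {cr3}[Ej3 Ec3 wt3 sub3 sz3] : crossed s3 bi A := cr3.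
have En3 : nmem s3 0 1 = n by rewrite (F3 0 isT) (F2 0 isT) (F1 0 isT).
have finish t s4 : t <= 60 * n.+2 + 60 -> nmem s4 j_ 0 = bi -> nmem s4 c_ 0 = 0 ->
    walk_to (output_walk s4) (bi, 0) -> {subset output_walk s3 <= output_walk s4} ->
    size (output_walk s4) = bi + (uphalf (size A)).*2 * n.+1 ->
    wp walk_up (fun t' => Q (3 + (3 + (t1 + (t2 + (t3 + (t + t'))))))) s4.
  move=> le_t Ej4 Ec4 wt4 sub4 sz4; apply: walk_up_spec Ej4 Ec4 wt4 _ => //.
  move=> t' s5 le_t' [q [Ew5 pq lq fr]] sub5 sz5; apply: HQ => //.
  - have : (60 * n.+2 + 400) * bi.+2 <= (60 * n.+2 + 400) * m.+2.
      by rewrite leq_mul2l; lia.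
    by rewrite !mulnS; move: le_t2; rewrite !mulnDl; lia.
  - by rewrite Ew5 /= pq lq eqxx /aisle_vertex /=; lia.
  - by rewrite /walk_cost sz5 sz4; lia.
  - by move=> v /sub3 /sub4 /sub5.
apply: wp_seq; apply: wp_if; rewrite [beval _ _]/= Ec3 => oddA.
- have {}oddA : odd (size A) by move: oddA; case: ifP.
  rewrite oddA in Ec3.
  apply: (@cross_spec _ _ bi) => //; first by right.
  move=> t4 s4 [F4 G4] le_t4; rewrite Ec3 subnn => Ec4 wt4 sub4 _ sz4.
  apply: finish => //; first by rewrite /=; lia.
    by rewrite (F4 j_ isT).
  by rewrite sz4 sz3 uphalfK oddA mulnDl mul1n; lia.
- have {}oddA : odd (size A) = false by move: oddA; case: ifP.
  rewrite oddA in Ec3; rewrite Ec3 in wt3.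
  apply: finish => //; first by rewrite /=; lia.
  by rewrite sz3 uphalfK oddA.
Qed.

End WalkSpec.

(** * Correctness and running time *)

Definition cop_fr_program : prog :=
  sum_rows;; floor_budget;; cost_table;; half_table;; choose_rows;; write_walk.

Lemma fitsE n b k i : 0 < i ->
  fits n b k i = ((uphalf k).*2 * n.+1 + i.-1.*2 <= b).
Proof. by case: i => // i _; rewrite /fits doubleS !addnS. Qed.

(* Past this budget every row can be crossed, so larger budgets are equivalent. *)
Lemma cost_cap m n k i : 0 < n -> k <= i -> 0 < i <= m ->
  (uphalf k).*2 * n.+1 + i.-1.*2 <= (m * n.+2).*2.
Proof.
move=> n0 ki im; apply: (@leq_trans (m.+1 * n.+1 + m.-1.*2)); last by nia.
apply: leq_add; last by lia.
by rewrite leq_mul2r uphalfK; lia.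
Qed.

Lemma time_total m n L t1 t2 t3 t4 t5 t6 : 0 < m -> 0 < n ->
  t1 <= m * (60 * n.+3 + 60) + 60 -> t2 <= 60 * (m * n.+2).*2 + 60 ->
  t3 <= 60 * m + 60 -> t4 <= 60 * m + 60 ->
  t5 <= (100 * L.+2 + 200) * m.*2 + 60 -> t6 <= (60 * n.+2 + 400) * m.+2 ->
  t1 + (t2 + (t3 + (t4 + (t5 + t6)))) <= 5000 * (m * n) + 500 * (m * L).
Proof.
move=> m0 n0 le1 le2 le3 le4 le5 le6.
have mn : m <= m * n by rewrite leq_pmulr.
have nm : n <= m * n by rewrite leq_pmull.
by lia.
Qed.

Section Assembly.

Variables (R : realType) (m n : nat) (r : vertex -> R) (B : R).
Hypotheses (m1 : 1 <= m) (n1 : 1 <= n) (hr : aisle_reward m n r) (B0 : (0 <= B)%R).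

(** A competing walk [w'] is replaced by its [visited_rows], a candidate set at stage [max_row w']
    worth at least as much; the lower bound on its cost makes this set fit. *)
Lemma walk_optimal (b i : nat) s w :
  b <= (m * n.+2).*2 -> (b%:R <= B)%R -> b = (m * n.+2).*2 \/ (B < b.+1%:R)%R ->
  (forall j, 1 <= j <= m -> rmem s 2 j = row_reward n r j) ->
  1 <= i <= m -> i = m \/ b < i.*2 -> best_so_far n b s i ->
  let bi := nmem s bi_ 0 in let A := active_at (nmem s 10) bi in
  closed_walk m n (1, 0) w -> full_row n w ->
  walk_cost w = (uphalf (size A)).*2 * n.+1 + (bi.-1).*2 ->
  {subset row_vertices n A <= w} -> cop_fr_optimal m n r B w.
Proof.
move=> bK bB bmax Ef im iend [bii E5 fitA opt] bi A cw fw cost sub.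
have sum_f S : {subset S <= iota 1 m} ->
    (\sum_(j <- S) rmem s 2 j = \sum_(j <- S) row_reward n r j)%R.
  move=> sS; rewrite !big_seq; apply: eq_bigr => j /sS; rewrite mem_iota => jm.
  by apply: Ef; lia.
split.
  split=> //; apply: le_trans bB; rewrite ler_nat cost.
  by rewrite -fitsE //; case/andP: bii.
move=> w' [cw' fw' cost']; apply: le_trans (walk_reward_le hr cw') _.
have sA : {subset A <= iota 1 m}.
  by move=> j; rewrite mem_filter !mem_iota => /andP[_]; lia.
have uA : uniq A by rewrite filter_uniq ?iota_uniq.
apply: le_trans (walk_reward_ge hr cw uA sub).
have sV : {subset visited_rows m n w' <= iota 1 m}.
  by move=> j; rewrite mem_filter => /andP[].
rewrite -(sum_f _ sV) -(sum_f _ sA) -E5.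
have mx := max_row_bounds cw'; have lb := full_row_cost cw' fw' n1.
have sS := @visited_rows_le_max m n w'.
have uS : uniq (visited_rows m n w') by rewrite filter_uniq ?iota_uniq.
have szS : size (visited_rows m n w') <= max_row w'.
  by have := uniq_leq_size uS sS; rewrite size_iota.
have [mx0 _] := andP mx.
have fitS : fits n b (size (visited_rows m n w')) (max_row w').
  (* Either [b] is the cap, within which every set fits, or [b] is the integer part of [B] and
     bounds the integral cost of [w']. *)
  rewrite fitsE //; case: bmax => [->|Bb]; first exact: cost_cap.
  apply: leq_trans lb _.
  by rewrite -ltnS -(ltr_nat R); apply: le_lt_trans cost' Bb.
apply: (opt (max_row w')) => //; rewrite mx0 /=.
(* If the selection stopped before row [m], a later row is out of reach: fitting at [max_row w']
   forces [2 max_row w' <= b + 2 < 2 i + 2]. *)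
case: iend => [->|bi2]; first by case/andP: mx.
have : (max_row w').*2 <= b.+2 by apply: leq_trans fitS; rewrite leq_addl.
by move: bi2; clear; lia.
Qed.

Lemma cop_fr_program_spec : wp cop_fr_program (fun t s =>
    cop_fr_optimal m n r B (output_walk s) /\
    t <= 5000 * (m * n) + 500 * (m * trunc_log 2 m)) (input_state m n r B).
Proof.
apply: wp_seq; apply: sum_rows_spec => t1 s1 [F1 G1] le1 Ek1 Ef1.
have Em1 : nmem s1 0 0 = m by rewrite (F1 0 isT).
have En1 : nmem s1 0 1 = n by rewrite (F1 0 isT).
apply: wp_seq; apply: (@floor_budget_spec _ B) Ek1 _ _ _ B0 _.
- by rewrite (F1 b_ isT).
- by rewrite (G1 3 isT).
- by rewrite (G1 1 isT).
move=> t2 s2 b [F2 G2] le2 Eb2 bK bB bmax.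
apply: wp_seq; apply: (@cost_table_spec _ m n).
- by rewrite (F2 0 isT).
- by rewrite (F2 0 isT).
- by rewrite (F2 8 isT) (F1 8 isT).
move=> t3 s3 [F3 G3] le3 E8.
apply: wp_seq; apply: (@half_table_spec _ m) => //.
  by rewrite (F3 0 isT) (F2 0 isT).
move=> t4 s4 [F4 G4] le4 E9.
have tab4 : tables m n b s4.
  split=> //; rewrite ?(F4 0 isT) ?(F4 b_ isT) ?(F3 0 isT) ?(F3 b_ isT) ?(F2 0 isT) //.
  by rewrite (F4 8 isT).
have Ef4 j : 1 <= j <= m -> rmem s4 2 j = row_reward n r j.
  by move=> jm; rewrite (G4 2 isT) (G3 2 isT) (G2 2 isT) Ef1.
apply: wp_seq; apply: (@choose_rows_spec _ m n b) => //.
- by move=> j jm; rewrite Ef4 //; apply: row_reward_ge0 hr _ _.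
- by rewrite (F4 i_ isT) (F3 i_ isT) (F2 i_ isT) (F1 i_ isT).
- by rewrite (F4 sz_ isT) (F3 sz_ isT) (F2 sz_ isT) (F1 sz_ isT).
- by move=> k; rewrite (F4 10 isT) (F3 10 isT) (F2 10 isT) (F1 10 isT).
- by move=> k; rewrite (F4 11 isT) (F3 11 isT) (F2 11 isT) (F1 11 isT).
- by rewrite (G4 4 isT) (G3 4 isT) (G2 4 isT) (G1 4 isT).
- by rewrite (G4 5 isT) (G3 5 isT) (G2 5 isT) (G1 5 isT).
move=> t5 s5 i [F5 G5] le5 im iend best; have [bii _ _ _] := best.
apply: (@write_walk_spec _ m n _ _ (nmem s5 bi_ 0)) => //; first by lia.
- by rewrite (F5 0 isT) (F4 0 isT) (F3 0 isT) (F2 0 isT).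
- by rewrite (F5 1 isT) (F4 1 isT) (F3 1 isT) (F2 1 isT) (F1 1 isT).
move=> t6 s6 le6 cw fw cost sub; split.
  apply: (@walk_optimal b i s5) => //.
  by move=> j jm; rewrite (G5 2 isT) Ef4.
apply: time_total le6 => //.
by move: le5; rewrite /discard_time /climb_time trunc_log2_double.
Qed.

(** This is [ln (1 + x) <= x] at [x = -1/2]. *)
Lemma half_le_ln2 : (2^-1 <= ln 2 :> R)%R.
Proof.
have := @le_ln1Dx R (- 2^-1)%R; have -> : (1 - 2^-1 = 2^-1 :> R)%R by lra.
by rewrite lnV ?posrE //; lra.
Qed.

(** Passes from the binary logarithm of the tree depth to the natural one of the time bound, by
    taking logarithms in [2 ^ trunc_log 2 m <= m]. *)
Lemma trunc_log2_le_ln : ((trunc_log 2 m)%:R <= 2 * ln m%:R :> R)%R.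
Proof.
have p : 2 ^ trunc_log 2 m <= m by apply: trunc_logP.
have : (ln (2 ^+ trunc_log 2 m) <= ln m%:R :> R)%R.
  by rewrite ler_ln ?posrE ?exprn_gt0 ?ltr0n // -natrX ler_nat.
rewrite lnXn // -[X in (X <= _ -> _)%R]mulr_natl; have := half_le_ln2.
have : (0 <= (trunc_log 2 m)%:R :> R)%R by [].
by move=> L0 h le; have := ler_wpM2l L0 h; lra.
Qed.

End Assembly.

Local Open Scope ring_scope.

Theorem theorem2 (R : realType) :
  exists (P : prog) (C : nat),
    forall (m n : nat) (r : vertex -> R) (B : R),
      (1 <= m)%N -> (1 <= n)%N -> aisle_reward m n r -> 0 <= B ->
      exists (t : nat) (s : state R),
        [/\ exec P (input_state m n r B) t s,
            cop_fr_optimal m n r B (output_walk s)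
          & t%:R <= C%:R * (m%:R * Num.max n%:R (ln m%:R)) :> R].
Proof.
(* The constant is [5000 + 2 * 500], the factor 2 coming from the change of logarithm. *)
exists cop_fr_program, 6000%N => m n r B m1 n1 hr B0.
have /wpP[t [s [E [opt le_t]]]] := cop_fr_program_spec m1 n1 hr B0.
exists t, s; split=> //.
have : t%:R <= (5000 * (m * n) + 500 * (m * trunc_log 2 m))%:R :> R by rewrite ler_nat.
rewrite natrD !natrM => {}le_t; apply: le_trans le_t _.
have Ll := trunc_log2_le_ln R m1.
have [NX lX] : n%:R <= Num.max n%:R (ln m%:R) :> R /\
    ln m%:R <= Num.max n%:R (ln m%:R) :> R by rewrite !le_max !lexx orbT.
have M0 : 0 <= m%:R :> R by [].
have := ler_wpM2l M0 NX; have := ler_wpM2l M0 lX; have := ler_wpM2l M0 Ll.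
by lra.
Qed.
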